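(* Let $d\ge2$ and let $\mathbb{P}$ satisfy Assumptions A1–A2 below, with $\epsilon,\lambda,\sigma$ as defined in the context. If $$\lambda>4d\sigma^2(1+9\epsilon),$$ then Kalikow's condition is satisfied in direction $e_1$. In particular, $X$ is ballistic in direction $e_1$, i.e. $\liminf_{n\to\infty}\frac{X_n\cdot e_1}{n}>0$ $P_0$-a.s.
   Context: Let $V=\{x\in\mathbb{Z}^d:|x|_1=1\}$, $\mathcal P$ the probability vectors on $V$, $\Omega=\mathcal P^{\mathbb{Z}^d}$; for $\omega\in\Omega$, $P_{x,\omega}$ is the law of the nearest-neighbour Markov chain $X$ from $x$ with $P_{x,\omega}(X_{n+1}=y+e\mid X_n=y)=\omega(y,e)$; $\mathbb{P}$ is a law on $\Omega$ and $P_x=\mathbb{P}\otimes P_{x,\omega}$ the annealed law. (A1) $\omega(x)$, $x\in\mathbb{Z}^d$, are i.i.d. with law $\mu$; (A2) $\epsilon:=4d\,\|\omega(0)-(\frac1{2d},\dots,\frac1{2d})\|_{L^\infty(\mu)}\in(0,1)$ (the essential sup over $e\in V$ of $|\omega(0,e)-\frac1{2d}|$, times $4d$). $\lambda:=\mathbb{E}(\omega(0,e_1)-\omega(0,-e_1))$, $\sigma:=\sqrt{\sum_{e\in V}\mathrm{Var}_\mu(\omega(0,e))}$. For $B\subsetneq\mathbb{Z}^d$ nonempty connected, $T_B=\inf\{n\ge0:X_n\notin B\}$ and $g_B(x,y,\omega)=E_{x,\omega}\big(\sum_{n=0}^{T_B}\mathbf 1_{\{X_n=y\}}\big)$. Kalikow's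 environment on $B$ from $x\in B$ is $\omega_B^x(y,e)=\mathbb{E}(g_B(x,y,\omega)\omega(y,e))/\mathbb{E}(g_B(x,y,\omega))$ for $y\in B$, and its drift is $\vec d_{B,x}(y)=\sum_{e\in V}\omega_B^x(y,e)e$. Kalikow's condition holds in direction $\ell\in S^{d-1}$ if $\varepsilon_K(\ell):=\inf\{\vec d_{B,0}(y)\cdot\ell: B\subsetneq\mathbb{Z}^d\text{ connected}, 0,y\in B\}>0$. *)

(* Defs.v *)
From HB Require Import structures.
From mathcomp Require Import all_boot all_order all_algebra.
From mathcomp Require Import all_classical all_reals all_analysis ess_sup_inf.
Set Implicit Arguments. Unset Strict Implicit. Unset Printing Implicit Defensive.
Import Order.TTheory GRing.Theory Num.Theory.
Import numFieldNormedType.Exports.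
Local Open Scope classical_set_scope.
Local Open Scope ring_scope.

Definition Zd (d : nat) := 'rV[int]_d.

(* The set V = {x in Z^d : |x|_1 = 1} is indexed by (coordinate, sign):
   (i, true) |-> +e_i, (i, false) |-> -e_i. *)
Definition Dir (d : nat) := ('I_d * bool)%type.

Definition unitv (d : nat) (e : Dir d) : Zd d :=
  \row_j (if j == e.1 then (if e.2 then 1 else -1) else 0).

Definition env (R : realType) (d : nat) := Zd d -> Dir d -> R.

Definition pos (d n : nat) (x : Zd d) (s : {ffun 'I_n -> Dir d}) (k : nat)
  : Zd d := x + \sum_(j < n | (j < k)%N) unitv (s j).

(* quenched probability P_{x,omega} that the first n steps are given by s *)
Definition path_weight (R : realType) (d n : nat) (w : env R d) (x : Zd d)
  (s : {ffun 'I_n -> Dir d}) : R :=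
  \prod_(k < n) w (pos x s k) (s k).

(* Green function g_B(x,y,omega) = E_{x,omega}[ sum_{n=0}^{T_B} 1{X_n = y} ]
   = sum_n P_{x,omega}(X_0, ..., X_n in B, X_n = y)   (for y in B). *)
Definition green (R : realType) (d : nat) (B : set (Zd d)) (x y : Zd d)
  (w : env R d) : \bar R :=
  (\sum_(0 <= n <oo)
     (\sum_(s : {ffun 'I_n -> Dir d} |
             [forall k : 'I_n.+1, pos x s k \in B] && (pos x s n == y))
        path_weight w x s)%:E)%E.

Definition nn_connected (d : nat) (B : set (Zd d)) : Prop :=
  forall x y, B x -> B y -> exists n (s : {ffun 'I_n -> Dir d}),
    (forall k : 'I_n.+1, B (pos x s k)) /\ pos x s n = y.

Section RWRE.
Context (R : realType) (d : nat) (dT : measure_display) (T : measurableType dT)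
  (P : probability T R).

Definition kalikow_env (om : T -> env R d) (B : set (Zd d)) (x y : Zd d)
  (e : Dir d) : R :=
  fine (\int[P]_t (green B x y (om t) * (om t y e)%:E))%E
  / fine (\int[P]_t green B x y (om t))%E.

Definition dotR (z : Zd d) (l : 'rV[R]_d) : R := \sum_i (z 0 i)%:~R * l 0 i.

Definition kalikow_drift_dot (om : T -> env R d) (B : set (Zd d)) (x y : Zd d)
  (l : 'rV[R]_d) : R :=
  \sum_(e : Dir d) kalikow_env om B x y e * dotR (unitv e) l.

Definition kalikow_condition (om : T -> env R d) (l : 'rV[R]_d) : Prop :=
  0 < inf [set r : R | exists (B : set (Zd d)) (y : Zd d),
             [/\ nn_connected B, B <> setT, B 0, B y &
                 r = kalikow_drift_dot om B 0 y l]].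

Definition prob_vectors (om : T -> env R d) : Prop :=
  (forall t x e, 0 <= om t x e) /\ (forall t x, \sum_(e : Dir d) om t x e = 1).

Definition iid_env (om : T -> env R d) : Prop :=
  [/\ (forall x e, measurable_fun setT (fun t => om t x e)),
      (forall x (A : Dir d -> set R), (forall e, measurable (A e)) ->
         P [set t | forall e, A e (om t x e)] = P [set t | forall e, A e (om t 0 e)])
    & (forall (S : seq (Zd d)) (A : Zd d -> Dir d -> set R), uniq S ->
         (forall x e, measurable (A x e)) ->
         fine (P [set t | forall x, x \in S -> forall e, A x e (om t x e)])
         = \prod_(x <- S) fine (P [set t | forall e, A x e (om t x e)]))].

Definition eps_env (om : T -> env R d) : R :=
  (4 * d%:R) * fine (ess_sup P
     (fun t => (\big[Num.max/0]_(e : Dir d) `|om t 0 e - (2 * d%:R)^-1|)%:E)).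

Definition e1idx (i : 'I_d) : bool := (val i == 0)%N.

Definition e1vec : 'rV[R]_d := \row_i (if e1idx i then 1 else 0).

Definition lambda_env (om : T -> env R d) : R :=
  fine ('E_P[fun t => (\sum_(e : Dir d | e1idx e.1)
                        (if e.2 then om t 0%R e else - om t 0%R e))%R])%E.

Definition sigma_env (om : T -> env R d) : R :=
  Num.sqrt (\sum_(e : Dir d) fine (variance P (fun t => om t 0 e))).

(* X is a process whose law is the annealed law P_0 = PP (x) P_{0,omega}:
   its finite-dimensional distributions are E[P_{0,omega}(X_0..X_n = path)] *)
Definition annealed_walk (om : T -> env R d) (X : nat -> T -> Zd d) : Prop :=
  (forall n z, measurable [set t | X n t = z]) /\
  (forall n (s : {ffun 'I_n -> Dir d}),
     P [set t | forall k : 'I_n.+1, X k t = pos 0 s k]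
     = (\int[P]_t (path_weight (om t) 0 s)%:E)%E).

End RWRE.

(* Main.v *)
Require Import Defs.
From HB Require Import structures.
From mathcomp Require Import all_boot all_order all_algebra.
From mathcomp Require Import all_classical all_reals all_analysis ess_sup_inf measurable_realfun.
From mathcomp Require Import zify ring lra.
Set Implicit Arguments. Unset Strict Implicit. Unset Printing Implicit Defensive.
Import Order.TTheory GRing.Theory Num.Theory.
Import numFieldNormedType.Exports.
Local Open Scope classical_set_scope.
Local Open Scope ring_scope.

(**
  Kalikow's condition. For a discount z < 1 the Green function is
  g(x, y) = h(x) / (1 - z sum_e w(y,e) h(y+e)), where the discounted probability h of hitting y
  does not involve w(y). Integrating w(y) out, the annealed drift at y is at least kalikow_const:
  expand 1/(sum_e w(y,e) a_e) to second order around its mean and use uniform ellipticity.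
  On finite sets, testing the annealed Green measure against a geometric barrier and against
  L - level bounds E g_B(0, y), the probability to leave {level >= 0} and the mean time to reach
  level L by constants that depend neither on z nor on the set, and z tends to 1.

  Ballisticity. After the first visit to level i, as long as the walk stays above i it only sees
  fresh environment, so the event that i is never undercut afterwards (i is a regeneration level)
  is independent of the past and has probability at least kalikow_const. Hence regeneration levels
  exist almost surely. Call a regeneration level i slow if some window [i, i + n) takes longer than
  a times its number of regeneration levels; a covering argument and E T_L <= L / c give
  P(i slow) <= 1 / (c a), so almost surely some regeneration level is not slow for a large a, which
  bounds the level of the walk from below linearly in time.
*)

(** * Bounded measurable functions and nonnegative series *)

Section BoundedMeasurable.
Context (R : realType) dT (T : measurableType dT).
Implicit Types f g : T -> R.

Definition bounded_mfun f : Prop :=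
  measurable_fun setT f /\ exists M, forall t, `|f t| <= M.

Lemma bounded_mfun_itv f (M : R) : measurable_fun setT f ->
  (forall t, 0 <= f t <= M) -> bounded_mfun f.
Proof.
by move=> mf f0M; split=> //; exists M => t; have /andP[f0 fM] := f0M t; rewrite ger0_norm.
Qed.

Lemma bounded_mfun_cst (k : R) : bounded_mfun (fun=> k).
Proof. by split; [exact: measurable_cst | exists `|k|]. Qed.

Lemma bounded_mfunD f g :
  bounded_mfun f -> bounded_mfun g -> bounded_mfun (fun t => f t + g t).
Proof.
move=> [mf [M fM]] [mg [N gN]]; split; first exact: measurable_funD.
by exists (M + N) => t; rewrite (le_trans (ler_normD _ _)) ?lerD.
Qed.

Lemma bounded_mfunM f g :
  bounded_mfun f -> bounded_mfun g -> bounded_mfun (fun t => f t * g t).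
Proof.
move=> [mf [M fM]] [mg [N gN]]; split; first exact: measurable_funM.
by exists (M * N) => t; rewrite normrM ler_pM.
Qed.

Lemma bounded_mfunN f : bounded_mfun f -> bounded_mfun (fun t => - f t).
Proof.
move=> [mf [M fM]]; split; first exact: measurableT_comp.
by exists M => t; rewrite normrN.
Qed.

Lemma bounded_mfunX f n : bounded_mfun f -> bounded_mfun (fun t => f t ^+ n).
Proof.
by move=> bf; elim: n => [|n IHn]; under eq_fun do rewrite ?expr0 ?exprS;
  [exact: bounded_mfun_cst | exact: bounded_mfunM].
Qed.

Lemma bounded_mfun_sum (I : Type) (r : seq I) (h : I -> T -> R) :
  (forall i, bounded_mfun (h i)) -> bounded_mfun (fun t => \sum_(i <- r) h i t).
Proof.
move=> bh; elim: r => [|i r IHr]; under eq_fun do rewrite ?big_nil ?big_cons.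
  exact: bounded_mfun_cst.
exact: bounded_mfunD.
Qed.

Lemma measurable_inv_ge0 f : measurable_fun setT f -> (forall t, 0 <= f t) ->
  measurable_fun setT (fun t => (f t)^-1).
Proof.
move=> mf f0; under eq_fun do rewrite -powR_inv1//.
by apply: (measurableT_comp (f := @powR R ^~ (-1))) => //; exact: measurable_powR.
Qed.

Lemma bounded_mfunV f (a : R) : 0 < a -> (forall t, a <= f t) ->
  bounded_mfun f -> bounded_mfun (fun t => (f t)^-1).
Proof.
move=> a0 af [mf _]; have f0 t : 0 < f t by exact: lt_le_trans (af t).
apply: (@bounded_mfun_itv _ a^-1).
  by apply: measurable_inv_ge0 => // t; exact: ltW.
by move=> t; rewrite invr_ge0 ltW//= lef_pV2 ?posrE.
Qed.

Lemma bounded_mfun_indic (A : set T) : measurable A -> bounded_mfun \1_A.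
Proof.
move=> mA; apply: (@bounded_mfun_itv _ 1); first exact: measurable_indic.
by move=> t; rewrite indicE ler0n lern1 leq_b1.
Qed.

Lemma bounded_mfun_integrable (P : probability T R) f :
  bounded_mfun f -> P.-integrable setT (EFin \o f).
Proof.
move=> [mf [M fM]]; have PT : (P setT < +oo)%E by rewrite probability_setT ltry.
apply: measurable_bounded_integrable => //.
exists M; split; first exact: num_real.
by move=> N MN t _ /=; rewrite (le_trans (fM t)) ?ltW.
Qed.

End BoundedMeasurable.

Lemma bounded_mfun_comp (R : realType) dT (T : measurableType dT) dS (S : measurableType dS)
    (f : T -> R) (h : S -> T) :
  bounded_mfun f -> measurable_fun setT h -> bounded_mfun (fun s => f (h s)).
Proof.
move=> [mf [M fM]] mh; split; first exact: measurableT_comp mf mh.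
by exists M => s; exact: fM.
Qed.

Create HintDb bounded_mfun.
#[local] Hint Resolve bounded_mfun_cst bounded_mfunD bounded_mfunM bounded_mfunN
  bounded_mfunX bounded_mfun_sum : bounded_mfun.
#[local] Hint Extern 0 (bounded_mfun _) => solve [auto 20 with nocore bounded_mfun] : core.
#[local] Hint Extern 0 (is_true (integrable _ _ _)) =>
  solve [apply: bounded_mfun_integrable; auto 20 with nocore bounded_mfun] : core.

Section RintegralBounded.
Context (R : realType) dT (T : measurableType dT) (P : probability T R).
Implicit Types f g : T -> R.

Lemma Rintegral_cstT (k : R) : \int[P]_t k = k.
Proof. by rewrite Rintegral_cst// (congr1 fine (probability_setT P)) mulr1. Qed.

Lemma EFin_Rintegral f : bounded_mfun f ->
  (\int[P]_t f t)%:E = (\int[P]_t (f t)%:E)%E.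
Proof. by move=> bf; rewrite /Rintegral fineK//; exact: integrable_fin_num. Qed.

Lemma Rintegral_sum (I : Type) (r : seq I) (h : I -> T -> R) :
  (forall i, bounded_mfun (h i)) ->
  \int[P]_t (\sum_(i <- r) h i t) = \sum_(i <- r) \int[P]_t h i t.
Proof.
move=> bh; elim: r => [|i r IHr]; under eq_Rintegral do rewrite ?big_nil ?big_cons.
  by rewrite big_nil Rintegral_cstT.
by rewrite RintegralD// ?IHr ?big_cons//.
Qed.

Lemma ae_le_Rintegral f g : bounded_mfun f -> bounded_mfun g ->
  {ae P, forall t, f t <= g t} -> \int[P]_t f t <= \int[P]_t g t.
Proof.
move=> bf bg fg; rewrite -subr_ge0 -RintegralB//.
have [mf _] := bf; have [mg _] := bg.
rewrite /Rintegral (ae_eq_integral (fun t => `|g t - f t|%:E)) //.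
- by apply: fine_ge0; exact: integral_ge0.
- by apply/measurable_EFinP; exact: measurable_funB.
- by apply/measurable_EFinP; apply: measurableT_comp => //; exact: measurable_funB.
- by apply: filterS fg => t fgt _; rewrite ger0_norm ?subr_ge0.
Qed.

End RintegralBounded.

Lemma Rintegral_prod (R : realType) d1 (T1 : measurableType d1) d2 (T2 : measurableType d2)
    (P1 : probability T1 R) (P2 : probability T2 R) (f : T1 * T2 -> R) : bounded_mfun f ->
  \int[(P1 \x P2)%E]_p f p = \int[P1]_s \int[P2]_t f (s, t).
Proof.
move=> bf; rewrite {1}/Rintegral -integral12_prod_meas1//; congr fine.
apply: eq_integral => s _; rewrite EFin_Rintegral//.
by apply: (bounded_mfun_comp bf); exact: pair1_measurable.
Qed.

Section NonnegativeSeries.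
Context (R : realType).

Lemma nneseries_le_ub (u : nat -> R) (C : R) : (forall n, 0 <= u n) ->
  (forall k, \sum_(n < k) u n <= C) -> (\sum_(0 <= n <oo) (u n)%:E <= C%:E)%E.
Proof.
move=> u0 uC; apply: lime_le; first by apply: is_cvg_nneseries => n _ _; rewrite lee_fin.
by apply: nearW => k; rewrite sumEFin lee_fin big_mkord.
Qed.

Lemma nneseries_ge_partial (u : nat -> R) k : (forall n, 0 <= u n) ->
  ((\sum_(n < k) u n)%:E <= \sum_(0 <= n <oo) (u n)%:E)%E.
Proof.
move=> u0; rewrite -sumEFin -(big_mkord xpredT (fun n => (u n)%:E)).
by apply: nneseries_lim_ge => n _ _; rewrite lee_fin.
Qed.

End NonnegativeSeries.

(** * Paths and the killed walk *)

Section Paths.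
Context (R : realType) (d : nat).
Implicit Types (w : env R d) (x y : Zd d) (s : seq (Dir d)) (B : set (Zd d)) (f : Zd d -> R).

Definition endpoint x s : Zd d := x + \sum_(e <- s) unitv e.

Lemma endpoint_nil x : endpoint x [::] = x.
Proof. by rewrite /endpoint big_nil addr0. Qed.

Lemma endpoint_cons x e s : endpoint x (e :: s) = endpoint (x + unitv e) s.
Proof. by rewrite /endpoint big_cons addrA. Qed.

Lemma endpoint_cat x s s' : endpoint x (s ++ s') = endpoint (endpoint x s) s'.
Proof. by rewrite /endpoint big_cat addrA. Qed.

Lemma endpoint_take_S x s e0 k : (k < size s)%N ->
  endpoint x (take k.+1 s) = endpoint x (take k s) + unitv (nth e0 s k).
Proof. by move=> ks; rewrite (take_nth e0)// /endpoint big_rcons/= addrA addrAC. Qed.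

Lemma unitv_inj : injective (@unitv d).
Proof.
move=> [i b] [i' b'] /rowP unitvE.
have := unitvE i; rewrite !mxE /= eqxx; case: eqP => [<-|_]; last by case: (b).
by case: (b); case: (b').
Qed.

Lemma endpoint_take_inj s s' : size s = size s' ->
  (forall k, (k <= size s)%N -> endpoint 0 (take k s) = endpoint 0 (take k s')) -> s = s'.
Proof.
move=> ss endE; case: s => [|e0 s0] in ss endE *; first by case: s' ss {endE}.
apply: (@eq_from_nth _ e0) => // k ks; apply: unitv_inj.
have := endE k.+1 ks; rewrite !(endpoint_take_S _ e0) -?ss// (endE k (ltnW ks)).
exact: addrI.
Qed.

Fixpoint seq_weight w x s : R :=
  if s is e :: s' then w x e * seq_weight w (x + unitv e) s' else 1.

Lemma seq_weight_cat w x s s' :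
  seq_weight w x (s ++ s') = seq_weight w x s * seq_weight w (endpoint x s) s'.
Proof.
elim: s x => [|e s IHs] x /=; first by rewrite mul1r endpoint_nil.
by rewrite IHs endpoint_cons mulrA.
Qed.

Lemma eq_seq_weight w w' x s :
  (forall k, (k < size s)%N -> w (endpoint x (take k s)) = w' (endpoint x (take k s))) ->
  seq_weight w x s = seq_weight w' x s.
Proof.
elim: s x => //= e s IHs x ww'; congr (_ * _).
  by have := ww' 0%N isT; rewrite endpoint_nil => ->.
by apply: IHs => k ks; have := ww' k.+1 ks; rewrite /= endpoint_cons.
Qed.

Lemma seq_weight_shift w x y s :
  seq_weight (fun u => w (x + u)) y s = seq_weight w (x + y) s.
Proof. by elim: s y => //= e s IHs y; rewrite IHs addrA. Qed.

Fixpoint inside B x s : bool :=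
  (x \in B) && (if s is e :: s' then inside B (x + unitv e) s' else true).

Lemma insideP B x s :
  reflect (forall k, (k <= size s)%N -> B (endpoint x (take k s))) (inside B x s).
Proof.
apply: (iffP idP); elim: s x => [|e s IHs] x /=.
- by rewrite andbT => /set_mem xB k _; rewrite endpoint_nil.
- move=> /andP[/set_mem xB /IHs sB] [|k] ks; first by rewrite endpoint_nil.
  by rewrite endpoint_cons; exact: sB.
- by move=> /(_ 0%N isT); rewrite endpoint_nil andbT => /mem_set.
move=> sB; apply/andP; split; first by have /= := sB 0%N isT; rewrite endpoint_nil => /mem_set.
by apply: IHs => k ks; have := sB k.+1 ks; rewrite endpoint_cons.
Qed.

Definition ffun_tuple n (s : n.-tuple (Dir d)) : {ffun 'I_n -> Dir d} :=
  [ffun i => tnth s i].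

Lemma ffun_tuple_bij n : bijective (@ffun_tuple n).
Proof.
exists (fun f : {ffun 'I_n -> Dir d} => [tuple f i | i < n]) => [s|f].
  by apply/eq_from_tnth => i; rewrite tnth_mktuple ffunE.
by apply/ffunP => i; rewrite ffunE tnth_mktuple.
Qed.

Lemma pos_ffun_tuple n x (s : n.-tuple (Dir d)) k :
  pos x (ffun_tuple s) k = endpoint x (take k s).
Proof.
elim: n x s k => [|n IHn] x s k; first by rewrite /pos big_ord0 tuple0 endpoint_nil addr0.
case/tupleP: s => e s; case: k => [|k].
  by rewrite /pos big_pred0// take0 endpoint_nil addr0.
rewrite /= endpoint_cons -IHn /pos big_mkcond big_ord_recl /= ffunE tnth0 addrA [in RHS]big_mkcond.
by congr (_ + _); apply: eq_bigr => j _; rewrite !ffunE tnthS.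
Qed.

Lemma path_weight_ffun_tuple n w x (s : n.-tuple (Dir d)) :
  path_weight w x (ffun_tuple s) = seq_weight w x s.
Proof.
rewrite /path_weight.
under eq_bigr do rewrite pos_ffun_tuple ffunE.
elim: n x s => [|n IHn] x s; first by rewrite big_ord0 tuple0.
rewrite big_ord_recl /=; case/tupleP: s => e s /=.
rewrite tnth0 endpoint_nil -IHn; congr (_ * _).
by apply: eq_bigr => i _; rewrite /= tnthS endpoint_cons.
Qed.

Lemma inside_ffun_tuple n B x (s : n.-tuple (Dir d)) :
  [forall k : 'I_n.+1, pos x (ffun_tuple s) k \in B] = inside B x s.
Proof.
apply/forallP/insideP => [sB k|sB k]; last first.
  by apply/mem_set; rewrite pos_ffun_tuple; apply: sB; rewrite size_tuple -ltnS.
rewrite size_tuple -ltnS => kn.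
by have /set_mem := sB (Ordinal kn); rewrite pos_ffun_tuple.
Qed.

Lemma big_tuple_cons n (F : n.+1.-tuple (Dir d) -> R) (Q : pred (n.+1.-tuple (Dir d))) :
  \sum_(u | Q u) F u =
  \sum_e \sum_(s : n.-tuple (Dir d) | Q [tuple of e :: s]) F [tuple of e :: s].
Proof.
rewrite (pair_big_dep xpredT (fun e (s : n.-tuple _) => Q [tuple of e :: s])) /=.
rewrite (reindex (fun p : Dir d * n.-tuple (Dir d) => [tuple of p.1 :: p.2])) //=.
exists (fun u => (thead u, [tuple of behead u])) => [[e s] _|u _] /=.
  by congr pair; apply/val_inj.
by rewrite [RHS]tuple_eta.
Qed.

Lemma big_tuple_cat n m (F : seq (Dir d) -> R) (C : pred (seq (Dir d))) :
  \sum_(u : (n + m).-tuple (Dir d) | C u) F u =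
  \sum_(s : n.-tuple (Dir d)) \sum_(s' : m.-tuple (Dir d) | C (s ++ s')) F (s ++ s').
Proof.
elim: n F C => [|n IHn] F C.
  by rewrite (big_pred1 [tuple]) => [|s]; last by apply/esym/eqP; exact: tuple0.
rewrite (big_tuple_cons (fun u => F (val u)) (fun u => C (val u))).
rewrite (big_tuple_cons (fun u => \sum_(s' : m.-tuple (Dir d) | C (val u ++ s')) F (val u ++ s'))
  xpredT).
by apply: eq_bigr => e _; exact: (IHn (fun u => F (e :: u)) (fun u => C (e :: u))).
Qed.

(* [killed B w n f x] is E_{x,w}[f(X_n); X_0, ..., X_n in B]. *)
Fixpoint killed B w n f x : R :=
  (x \in B)%:R *
  (if n is m.+1 then \sum_(e : Dir d) w x e * killed B w m f (x + unitv e) else f x).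

Definition killed_prob B w n x y : R := killed B w n (fun u => (u == y)%:R) x.

Definition survival B w n x : R := killed B w n (fun=> 1) x.

Lemma killed_tupleE B w n f x :
  \sum_(s : n.-tuple (Dir d) | inside B x s) seq_weight w x s * f (endpoint x s) =
  killed B w n f x.
Proof.
elim: n x => [|n IHn] x /=.
  rewrite big_mkcond /= (big_pred1 [tuple]) => [|s]; last by apply/esym/eqP; exact: tuple0.
  by rewrite /= endpoint_nil andbT mul1r; case: (x \in B); rewrite ?mul1r ?mul0r.
rewrite big_tuple_cons /=; case: (x \in B); last by rewrite mul0r big1// => e _; exact: big_pred0.
rewrite mul1r; apply: eq_bigr => e _; rewrite -IHn mulr_sumr.
by apply: eq_bigr => s _; rewrite endpoint_cons mulrA.
Qed.

Lemma greenE B x y w : green B x y w = (\sum_(0 <= n <oo) (killed_prob B w n x y)%:E)%E.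
Proof.
apply: eq_eseriesr => n _; congr EFin; rewrite /killed_prob -killed_tupleE.
rewrite (reindex (@ffun_tuple n)) /=; last exact/onW_bij/ffun_tuple_bij.
rewrite big_mkcondr; apply: eq_big => [s|s _]; first exact: inside_ffun_tuple.
rewrite path_weight_ffun_tuple pos_ffun_tuple take_oversize ?size_tuple//.
by case: eqP; rewrite ?mulr1 ?mulr0.
Qed.

Lemma killed_notin B w n f x : x \notin B -> killed B w n f x = 0.
Proof. by case: n => [|n] /negbTE /= ->; rewrite mul0r. Qed.

Lemma killed_eq0 B w n f x : (forall u, u \in B -> f u = 0) -> killed B w n f x = 0.
Proof.
move=> fB; elim: n x => [|n IHn] x /=.
  by case: (boolP (x \in B)) => [/fB ->|_]; rewrite ?mulr0 ?mul0r.
by rewrite big1 ?mulr0// => e _; rewrite IHn mulr0.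
Qed.

Lemma killed_prob_notin B w n x y : y \notin B -> killed_prob B w n x y = 0.
Proof.
by move=> yB; apply: killed_eq0 => u uB; case: eqP => // uy; rewrite -uy uB in yB.
Qed.

Lemma killed_sum_prob B w n f x (r : seq (Zd d)) : uniq r -> (forall y, B y -> y \in r) ->
  killed B w n f x = \sum_(y <- r) killed_prob B w n x y * f y.
Proof.
move=> ur Br; rewrite /killed_prob; elim: n x => [|n IHn] x /=.
  case: (boolP (x \in B)) => xB; last by rewrite mul0r big1// => y _; rewrite !mul0r.
  rewrite (bigD1_seq x) ?Br//=; last exact/set_mem.
  by rewrite eqxx mulr1 big1 ?addr0// => y; rewrite eq_sym => /negbTE ->; rewrite mulr0 mul0r.
under [RHS]eq_bigr do rewrite -mulrA mulr_suml.
rewrite -mulr_sumr exchange_big; congr (_ * _); apply: eq_bigr => e _.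
by rewrite IHn mulr_sumr; apply: eq_bigr => y _; rewrite mulrA.
Qed.

Definition substochastic w : Prop := (forall x e, 0 <= w x e) /\ (forall x, \sum_e w x e <= 1).

Lemma substochastic_le1 w x e : substochastic w -> w x e <= 1.
Proof.
by move=> [w0 w1]; rewrite (le_trans _ (w1 x))// (bigD1 e)//= lerDl sumr_ge0.
Qed.

Lemma substochastic_mean_le w x (f : Dir d -> R) M : substochastic w -> 0 <= M ->
  (forall e, f e <= M) -> \sum_e w x e * f e <= M.
Proof.
move=> [w0 w1] M0 fM; apply: (@le_trans _ _ (\sum_e w x e * M)).
  by apply: ler_sum => e _; rewrite ler_wpM2l.
by rewrite -mulr_suml ler_piMl.
Qed.

Lemma seq_weight_itv w x s : substochastic w -> 0 <= seq_weight w x s <= 1.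
Proof.
move=> hw; elim: s x => [|e s IHs] x /=; first by rewrite ler01 lexx.
have /andP[s0 s1] := IHs (x + unitv e).
by rewrite mulr_ge0 ?hw.1//= -[leRHS]mulr1 ler_pM ?hw.1 ?substochastic_le1.
Qed.

Lemma killed_itv B w n f x : substochastic w -> (forall u, 0 <= f u <= 1) ->
  0 <= killed B w n f x <= 1.
Proof.
move=> hw f01; elim: n x => [|n IHn] x /=.
  by case: (x \in B); rewrite ?mul1r ?mul0r// lexx ler01.
case: (x \in B); rewrite ?mul1r ?mul0r ?lexx ?ler01//.
rewrite sumr_ge0 => [|e _]; last by rewrite mulr_ge0 ?hw.1//; case/andP: (IHn (x + unitv e)).
by apply: substochastic_mean_le => // e; case/andP: (IHn (x + unitv e)).
Qed.

Lemma killed_prob_itv B w n x y : substochastic w -> 0 <= killed_prob B w n x y <= 1.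
Proof. by move=> hw; apply: killed_itv => // u; rewrite ler0n lern1 leq_b1. Qed.

Lemma killed_prob_ge0 B w n x y : substochastic w -> 0 <= killed_prob B w n x y.
Proof. by move=> hw; case/andP: (killed_prob_itv B n x y hw). Qed.

Lemma killed_prob_le1 B w n x y : substochastic w -> killed_prob B w n x y <= 1.
Proof. by move=> hw; case/andP: (killed_prob_itv B n x y hw). Qed.

Lemma green_ge0 B x y w : substochastic w -> (0 <= green B x y w)%E.
Proof.
by move=> hw; rewrite greenE nneseries_ge0// => n _ _; rewrite lee_fin killed_prob_ge0.
Qed.

Lemma survival_itv B w n x : substochastic w -> 0 <= survival B w n x <= 1.
Proof. by move=> hw; apply: killed_itv => // u; rewrite ler01 lexx. Qed.

Lemma survival_setT w n x : (forall u, \sum_e w u e = 1) -> survival setT w n x = 1.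
Proof.
move=> w1; rewrite /survival; elim: n x => [|n IHn] x /=; rewrite in_setT mul1r//.
by under eq_bigr do rewrite IHn mulr1.
Qed.

Fixpoint reach N : seq (Zd d) :=
  if N is n.+1 then undup (reach n ++ [seq x + unitv e | x <- reach n, e <- enum {: Dir d}])
  else [:: 0].

Lemma reach_uniq N : uniq (reach N).
Proof. by case: N => //= n; apply: undup_uniq. Qed.

Lemma reach_step N x e : x \in reach N -> x + unitv e \in reach N.+1.
Proof.
move=> xr /=; rewrite mem_undup mem_cat; apply/orP; right.
by apply/allpairsP; exists (x, e); rewrite /= mem_enum.
Qed.

Lemma reach_mono k N x : (k <= N)%N -> x \in reach k -> x \in reach N.
Proof.
move=> /subnK <-; elim: (N - k)%N => // m IHm /IHm xr; rewrite addSn /=.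
by rewrite mem_undup mem_cat xr.
Qed.

Lemma origin_in_reach N : 0 \in reach N.
Proof. by apply: (@reach_mono 0); rewrite ?inE. Qed.

Definition truncation B N : set (Zd d) := B `&` [set` reach N].

Lemma truncation_sub_reach B N x : truncation B N x -> x \in reach N.
Proof. by case. Qed.

Lemma origin_in_truncation B N : B 0 -> truncation B N 0.
Proof. by move=> B0; split; [|exact: origin_in_reach]. Qed.

Lemma mem_truncation B N k x : (k <= N)%N -> x \in reach k ->
  (x \in truncation B N) = (x \in B).
Proof.
move=> kN xr; rewrite in_setI andb_idr// => _.
by apply/mem_set; exact: reach_mono xr.
Qed.

Lemma killed_truncation B w f N n k x : x \in reach k -> (n + k <= N)%N ->
  killed (truncation B N) w n f x = killed B w n f x.
Proof.
elim: n k x => [|n IHn] k x xr nk /=; rewrite (mem_truncation _ _ xr)//; try lia.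
congr (_ * _); apply: eq_bigr => e _; congr (_ * _).
by apply: (IHn k.+1); [exact: reach_step | lia].
Qed.

Lemma killed_truncation_origin B w f N n : (n <= N)%N ->
  killed (truncation B N) w n f 0 = killed B w n f 0.
Proof. by move=> nN; apply: (@killed_truncation B w f N n 0); rewrite ?inE ?addn0. Qed.

End Paths.

(** * The discounted Green function *)

Section DiscountedGreen.
Context (R : realType) (d : nat).
Implicit Types (w : env R d) (x y : Zd d) (B : set (Zd d)).
Variable z : R.
Hypothesis z01 : 0 <= z < 1.
Let z_ge0 : 0 <= z. Proof. by case/andP: z01. Qed.
Let z_lt1 : z < 1. Proof. by case/andP: z01. Qed.

Lemma discounted_max_principle w (u : Zd d -> R) M : substochastic w ->
  (forall x, u x <= M) ->
  (forall x, u x <= 0 \/ u x <= z * \sum_e w x e * u (x + unitv e)) ->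
  forall x, u x <= 0.
Proof.
move=> hw uM hu x.
have u_geom n : forall x, u x <= z ^+ n * `|M|.
  elim: n => [|n IHn] x'; first by rewrite mul1r (le_trans (uM _)) ?ler_norm.
  have zM0 : 0 <= z ^+ n * `|M| by rewrite mulr_ge0 ?exprn_ge0.
  case: (hu x') => [u0|/le_trans]; first by rewrite (le_trans u0)// mulr_ge0 ?exprn_ge0.
  by apply; rewrite exprS -mulrA ler_wpM2l// substochastic_mean_le.
have zM_cvg0 : (fun n => z ^+ n * `|M|) @ \oo --> 0.
  rewrite -[X in _ --> X](mul0r `|M|); apply: cvgM; last exact: cvg_cst.
  by apply: cvg_expr; rewrite ger0_norm.
rewrite -(cvg_lim _ zM_cvg0)//; apply: limr_ge; first exact: cvgP zM_cvg0.
exact: nearW.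
Qed.

Lemma discounted_harmonic_eq0 w B (v : Zd d -> R) M : substochastic w ->
  (forall x, `|v x| <= M) ->
  (forall x, v x = (x \in B)%:R * (z * \sum_e w x e * v (x + unitv e))) ->
  forall x, v x = 0.
Proof.
move=> hw vM vE x; apply/eqP; rewrite -normr_le0.
apply: (@discounted_max_principle w (fun x => `|v x|) M) => // x'.
case: (boolP (x' \in B)) (vE x') => _ ->; last by left; rewrite mul0r normr0.
right; rewrite mul1r normrM ger0_norm// ler_wpM2l// (le_trans (ler_norm_sum _ _ _))//.
by apply: ler_sum => e _; rewrite normrM ger0_norm ?hw.1.
Qed.

Definition dgreen B w x y : R := limn (series (fun n => z ^+ n * killed_prob B w n x y)).

Lemma is_cvg_dgreen B w x y : substochastic w ->
  cvgn (series (fun n => z ^+ n * killed_prob B w n x y)).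
Proof.
move=> hw; apply: (@series_le_cvg _ _ (geometric 1 z)) => [n|n|n|] /=.
- by rewrite mulr_ge0 ?exprn_ge0 ?killed_prob_ge0.
- by rewrite mul1r exprn_ge0.
- by rewrite mul1r ler_piMr ?exprn_ge0 ?killed_prob_le1.
- by apply: is_cvg_geometric_series; rewrite ger0_norm.
Qed.

Lemma dgreen_ge_partial B w x y N : substochastic w ->
  \sum_(n < N) z ^+ n * killed_prob B w n x y <= dgreen B w x y.
Proof.
move=> hw; rewrite -(big_mkord xpredT (fun n => z ^+ n * killed_prob B w n x y)).
apply: (nondecreasing_cvgn_le (u_ := series (fun n => z ^+ n * killed_prob B w n x y))).
  by apply: nondecreasing_series => n _ _; rewrite mulr_ge0 ?exprn_ge0 ?killed_prob_ge0.
exact: is_cvg_dgreen.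
Qed.

Lemma dgreen_itv B w x y : substochastic w -> 0 <= dgreen B w x y <= (1 - z)^-1.
Proof.
move=> hw; apply/andP; split; first by have := dgreen_ge_partial B x y 0 hw; rewrite big_ord0.
apply: limr_le; [exact: is_cvg_dgreen | apply: nearW => n].
have geom_cvg : series (geometric 1 z) @ \oo --> (1 - z)^-1.
  by rewrite -[X in _ --> X]mul1r; apply: cvg_geometric_series; rewrite ger0_norm.
apply: (@le_trans _ _ (series (geometric 1 z) n)).
  by apply: ler_sum => k _ /=; rewrite mul1r ler_piMr ?exprn_ge0 ?killed_prob_le1.
rewrite -(cvg_lim _ geom_cvg)//; apply: nondecreasing_cvgn_le; last exact: cvgP geom_cvg.
by apply: nondecreasing_series => k _ _ /=; rewrite mul1r exprn_ge0.
Qed.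

Lemma dgreen_ge0 B w x y : substochastic w -> 0 <= dgreen B w x y.
Proof. by move=> hw; case/andP: (dgreen_itv B x y hw). Qed.

Lemma dgreen_le B w x y : substochastic w -> dgreen B w x y <= (1 - z)^-1.
Proof. by move=> hw; case/andP: (dgreen_itv B x y hw). Qed.

Lemma dgreen_notin B w x y : y \notin B -> dgreen B w x y = 0.
Proof.
move=> yB; rewrite /dgreen; under eq_fun do rewrite killed_prob_notin// mulr0.
by apply: lim_near_cst => //; apply: nearW => n; rewrite /series /= big1.
Qed.

Lemma dgreenE B w x y : substochastic w ->
  dgreen B w x y =
  (x \in B)%:R * ((x == y)%:R + z * \sum_e w x e * dgreen B w (x + unitv e) y).
Proof.
move=> hw; pose partial x := series (fun n => z ^+ n * killed_prob B w n x y).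
have partialS n : partial x n.+1 =
    (x \in B)%:R * ((x == y)%:R + z * \sum_e w x e * partial (x + unitv e) n).
  rewrite /partial /series /= big_nat_recl// expr0 mul1r {1}/killed_prob /= mulrDr; congr (_ + _).
  under [X in _ = _ * (_ * X)]eq_bigr => e _ do rewrite mulr_sumr.
  rewrite exchange_big /= !mulr_sumr; apply: eq_bigr => k _.
  by rewrite exprS /killed_prob /= !mulr_sumr; apply: eq_bigr => e _; ring.
apply: cvg_lim => //; rewrite -cvg_shiftS /= (funext partialS).
apply: cvgM; first exact: cvg_cst.
apply: cvgD; first exact: cvg_cst.
apply: cvgM; first exact: cvg_cst.
apply: cvg_big => [|e _]; first exact: add_continuous.
by apply: cvgM; [exact: cvg_cst | exact: is_cvg_dgreen].
Qed.

Lemma dgreen_le_green B w x y : substochastic w -> ((dgreen B w x y)%:E <= green B x y w)%E.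
Proof.
move=> hw; rewrite greenE; have cv := @is_cvg_dgreen B _ x y hw; rewrite /dgreen -EFin_lim//.
apply: lime_le.
  by apply/cvg_ex; exists (dgreen B w x y)%:E; apply: cvg_EFin; [exact: nearW | exact: cv].
apply: nearW => n /=; rewrite /series /= big_mkord.
apply: le_trans (nneseries_ge_partial n (fun k => killed_prob_ge0 B k x y hw)).
rewrite lee_fin ler_sum// => k _; rewrite ler_piMl ?killed_prob_ge0//.
by rewrite exprn_ile1// ltW.
Qed.

Definition stop_at y w : env R d := fun x e => if x == y then 0 else w x e.

Lemma stop_at_substochastic y w : substochastic w -> substochastic (stop_at y w).
Proof.
move=> [w0 w1]; split=> [x e|x]; rewrite /stop_at; first by case: ifP.
by case: (x == y) => //; rewrite big1.
Qed.

Lemma stop_at_neq x y w : x != y -> stop_at y w x = w x.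
Proof. by move=> xy; apply/funext => e; rewrite /stop_at (negbTE xy). Qed.

Lemma dgreen_stop_at_self B w y : substochastic w -> y \in B -> dgreen B (stop_at y w) y y = 1.
Proof.
move=> hw yB; rewrite dgreenE; last exact: stop_at_substochastic.
rewrite yB eqxx mul1r big1 ?mulr0 ?addr0// => e _.
by rewrite /stop_at eqxx mul0r.
Qed.

Lemma dgreen_stop_at_le1 B w x y : substochastic w -> y \in B -> dgreen B (stop_at y w) x y <= 1.
Proof.
move=> hw yB; have hw' := stop_at_substochastic y hw; rewrite -subr_le0.
apply: (@discounted_max_principle w (fun x => dgreen B (stop_at y w) x y - 1) (1 - z)^-1 hw).
  by move=> x'; rewrite lerBlDr ler_wpDr ?dgreen_le.
move=> x'; have [->|x'y] := eqVneq x' y; first by left; rewrite dgreen_stop_at_self// subrr.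
rewrite dgreenE// (negbTE x'y) add0r stop_at_neq//.
case: (x' \in B); last by left; rewrite mul0r sub0r lerN10.
right; rewrite mul1r; under [X in _ <= z * X]eq_bigr do rewrite mulrBr mulr1.
rewrite sumrB mulrBr lerD2l lerN2 mulr_ile1 ?hw.2 ?(ltW z_lt1)//.
by apply: sumr_ge0 => e _; exact: hw.1.
Qed.

(* Deleting the exits of [y] turns the Green function into the discounted probability of
   hitting [y], which does not depend on [w y]. *)
Lemma dgreen_first_passage B w x y : substochastic w -> y \in B ->
  dgreen B w x y = dgreen B (stop_at y w) x y * dgreen B w y y.
Proof.
move=> hw yB; have hw' := stop_at_substochastic y hw; set h := dgreen B (stop_at y w).
apply/eqP; rewrite -subr_eq0; apply/eqP; move: x.
apply: (@discounted_harmonic_eq0 (stop_at y w) B _ ((1 - z)^-1 + 1 * (1 - z)^-1)) => // x.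
  rewrite (le_trans (ler_normB _ _))// lerD ?normrM ?ler_pM//.
  - by rewrite ger0_norm ?dgreen_ge0 ?dgreen_le.
  - by rewrite ger0_norm ?dgreen_ge0 ?dgreen_stop_at_le1.
  - by rewrite ger0_norm ?dgreen_ge0 ?dgreen_le.
have [->|xy] := eqVneq x y.
  rewrite /h dgreen_stop_at_self// mul1r subrr big1 ?mulr0// => e _.
  by rewrite /stop_at eqxx mul0r.
rewrite [in LHS]dgreenE// /h [in LHS](dgreenE _ _ _ hw') (negbTE xy) !add0r stop_at_neq// -/h.
rewrite -!mulrA -mulrBr -mulrBr; congr (_ * (_ * _)).
by rewrite mulr_suml -sumrB; apply: eq_bigr => e _; rewrite mulrBr mulrA.
Qed.

Lemma dgreen_return B w y : substochastic w -> y \in B ->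
  dgreen B w y y = (1 - z * \sum_e w y e * dgreen B (stop_at y w) (y + unitv e) y)^-1.
Proof.
move=> hw yB; set q := z * _.
have q1 : q < 1.
  rewrite (le_lt_trans _ z_lt1)// ler_piMr//.
  by apply: substochastic_mean_le => // e; exact: dgreen_stop_at_le1.
have renewal : dgreen B w y y = 1 + q * dgreen B w y y.
  rewrite [LHS]dgreenE// yB eqxx mul1r /q -mulrA mulr_suml.
  congr (_ + z * _); apply: eq_bigr => e _.
  by rewrite dgreen_first_passage// mulrA.
have q_neq : 1 - q != 0 by rewrite subr_eq0 gt_eqF.
by apply: (mulIf q_neq); rewrite mulVf// mulrBr mulr1 {1}renewal mulrC; ring.
Qed.

Lemma dgreen_potentialE B w x (r : seq (Zd d)) (phi : Zd d -> R) : substochastic w ->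
  uniq r -> (forall y, B y -> y \in r) ->
  \sum_(y <- r) dgreen B w x y * phi y =
  (x \in B)%:R *
    (phi x + z * \sum_e w x e * \sum_(y <- r) dgreen B w (x + unitv e) y * phi y).
Proof.
move=> hw ur Br; under eq_bigr do rewrite dgreenE// -mulrA.
rewrite -mulr_sumr; case: (boolP (x \in B)) => xB; last by rewrite !mul0r.
rewrite !mul1r; under eq_bigr do rewrite mulrDl.
rewrite big_split /=; congr (_ + _).
  rewrite (bigD1_seq x) ?Br//=; last exact/set_mem.
  by rewrite eqxx mul1r big1 ?addr0// => y; rewrite eq_sym => /negbTE ->; rewrite mul0r.
under eq_bigr do rewrite -mulrA mulr_suml.
rewrite -mulr_sumr exchange_big /=; congr (_ * _); apply: eq_bigr => e _.
by rewrite mulr_sumr; apply: eq_bigr => y _; rewrite mulrA.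
Qed.

Lemma dgreen_dynkin B w x (r : seq (Zd d)) (f : Zd d -> R) : substochastic w ->
  uniq r -> (forall y, B y -> y \in r) ->
  \sum_(y <- r) dgreen B w x y *
    (f y - z * \sum_e w y e * ((y + unitv e \in B)%:R * f (y + unitv e)))
  = (x \in B)%:R * f x.
Proof.
move=> hw ur Br.
pose phi y := f y - z * \sum_e w y e * ((y + unitv e \in B)%:R * f (y + unitv e)).
pose U x := \sum_(y <- r) dgreen B w x y * phi y.
apply/eqP; rewrite -subr_eq0 -/(U x); apply/eqP; move: x.
apply: (@discounted_harmonic_eq0 w B _
  (\sum_(y <- r) (1 - z)^-1 * `|phi y| + \sum_(y <- r) `|f y|)) => // x.
  apply: (le_trans (ler_normB _ _)); apply: lerD.
    apply: (le_trans (ler_norm_sum _ _ _)); apply: ler_sum => y _.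
    by rewrite normrM ler_pM// ger0_norm ?dgreen_ge0 ?dgreen_le.
  case: (boolP (x \in B)) => xB; last by rewrite mul0r normr0 sumr_ge0.
  by rewrite mul1r (bigD1_seq x) ?Br ?lerDl ?sumr_ge0//; exact/set_mem.
rewrite {1}/U dgreen_potentialE// -mulrBr {1}/phi; congr (_ * _).
rewrite addrAC [_ - _ - f x]addrAC subrr add0r addrC -mulrBr -sumrB.
by congr (_ * _); apply: eq_bigr => e _; rewrite mulrBr.
Qed.

Lemma discounted_exit_prob_le B w N n k x : substochastic w -> (forall x, \sum_e w x e = 1) ->
  x \in reach d k -> (n + k <= N)%N -> x \in B ->
  z ^+ n * (1 - survival B w n x) <=
  \sum_(y <- reach d N) dgreen (truncation B N) w x y *
     (z * \sum_e w y e * (y + unitv e \notin B)%:R).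
Proof.
move=> hw w1; pose phi y := z * \sum_e w y e * (y + unitv e \notin B)%:R.
have phi_ge0 y : 0 <= phi y.
  by rewrite mulr_ge0// sumr_ge0// => e _; rewrite mulr_ge0 ?ler0n ?hw.1.
have sum_ge0 u : 0 <= \sum_(y <- reach d N) dgreen (truncation B N) w u y * phi y.
  by apply: sumr_ge0 => y _; rewrite mulr_ge0 ?dgreen_ge0.
rewrite /survival; elim: n k x => [|n IHn] k x xr nk xB.
  by rewrite /= xB mulr1 subrr mulr0 sum_ge0.
rewrite dgreen_potentialE ?reach_uniq//; last exact: truncation_sub_reach.
rewrite (mem_truncation _ _ xr) ?xB ?mul1r /=; last by lia.
rewrite xB mul1r -{1}(w1 x) -sumrB /phi -mulrDr -big_split /= mulr_sumr mulr_sumr.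
apply: ler_sum => e _; rewrite -{1}[w x e]mulr1 -mulrBr -mulrDr mulrCA [leRHS]mulrCA.
rewrite ler_wpM2l ?hw.1// exprS -mulrA ler_wpM2l//.
have [eB|eB] := boolP (x + unitv e \in B).
  by rewrite add0r; apply: (IHn k.+1) => //; [exact: reach_step | lia].
rewrite killed_notin// subr0 mulr1.
by rewrite ler_wpDr ?exprn_ile1 ?sum_ge0 ?(ltW z_lt1).
Qed.

End DiscountedGreen.

(** * The law of the environment *)

Section EnvironmentSpace.
Context (R : realType) (d : nat).
Implicit Types (S : seq (Zd d)) (C : Zd d -> Dir d -> set R).

Definition rectangle S C : set (env R d) := [set w | forall x, x \in S -> forall e, C x e (w x e)].

Definition rectangles : set (set (env R d)) :=
  [set A | exists S C, (forall x e, measurable (C x e)) /\ A = rectangle S C].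

Definition env_space : measurableType rectangles.-sigma := g_sigma_algebraType rectangles.

Lemma rectangles_setI : setI_closed rectangles.
Proof.
move=> _ _ [S [C [mC ->]]] [S' [C' [mC' ->]]].
exists (S ++ S'), (fun x e => (if x \in S then C x e else setT) `&`
                              (if x \in S' then C' x e else setT)).
split=> [x e|]; first by apply: measurableI; case: ifP.
apply/seteqP; split=> w /=.
  move=> [wC wC'] x _ e; split.
    by case: ifP => // /wC; apply.
  by case: ifP => // /wC'; apply.
move=> wCC'; split=> x xS e; have xSS' : x \in S ++ S' by rewrite mem_cat xS ?orbT.
  by have [] := wCC' x xSS' e; rewrite xS.
by have [_] := wCC' x xSS' e; rewrite xS.
Qed.

Lemma measurable_coord x e : measurable_fun [set: env_space] (fun w : env_space => w x e).
Proof.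
move=> _ Y mY; rewrite setTI; apply: sub_sigma_algebra.
exists [:: x], (fun _ e' => if e' == e then Y else setT); split=> [_ e'|]; first by case: ifP.
apply/seteqP; split=> w /= wY.
  by move=> x'; rewrite inE => /eqP -> e'; case: eqP => // ->.
by have := wY x (mem_head _ _) e; rewrite eqxx.
Qed.

Definition measurable_coords dT (T : measurableType dT) (om : T -> env R d) : Prop :=
  forall x e, measurable_fun setT (fun t => om t x e).

Lemma measurable_rectangle dT (T : measurableType dT) (om : T -> env R d) S C :
  measurable_coords om ->
  (forall x e, measurable (C x e)) ->
  measurable [set t | rectangle S C (om t)].
Proof.
move=> mom mC.
rewrite [X in measurable X](_ : _ =
    \bigcap_(x in [set` S]) \bigcap_(e in [set: Dir d]) ((fun t => om t x e) @^-1` C x e));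
  last first.
  by apply/seteqP; split=> t /= tC x xS e => [_|]; apply: tC.
apply: fin_bigcap_measurable => // x xS.
apply: fin_bigcap_measurable => [|e _]; first exact: finite_finset.
by rewrite -[X in measurable X]setTI; apply: mom.
Qed.

Lemma measurable_env dT (T : measurableType dT) (om : T -> env_space) :
  measurable_coords om -> measurable_fun setT om.
Proof.
move=> mom; apply: measurability => // _ [_ [S [C [mC ->]]] <-].
by rewrite setTI; apply: measurable_rectangle.
Qed.

Lemma eq_env_law d1 (T1 : measurableType d1) d2 (T2 : measurableType d2)
    (P1 : probability T1 R) (P2 : probability T2 R) (om1 : T1 -> env R d) (om2 : T2 -> env R d) :
  measurable_coords om1 -> measurable_coords om2 ->
  (forall S C, uniq S -> (forall x e, measurable (C x e)) ->
    P1 [set t | rectangle S C (om1 t)] = P2 [set t | rectangle S C (om2 t)]) ->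
  forall psi : env_space -> R, bounded_mfun psi ->
  \int[P1]_t psi (om1 t) = \int[P2]_t psi (om2 t).
Proof.
move=> mom1 mom2 eqP12 psi bpsi; have [mpsi _] := bpsi.
pose f1 : T1 -> env_space := om1; pose f2 : T2 -> env_space := om2.
have mf1 : measurable_fun setT f1 := measurable_env mom1.
have mf2 : measurable_fun setT f2 := measurable_env mom2.
have mEpsi : measurable_fun setT (EFin \o psi) by exact/measurable_EFinP.
have i1 : P1.-integrable (f1 @^-1` setT) ((EFin \o psi) \o f1).
  by rewrite preimage_setT; exact/bounded_mfun_integrable/(bounded_mfun_comp bpsi mf1).
have i2 : P2.-integrable (f2 @^-1` setT) ((EFin \o psi) \o f2).
  by rewrite preimage_setT; exact/bounded_mfun_integrable/(bounded_mfun_comp bpsi mf2).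
rewrite /Rintegral; congr fine.
have := integral_pushforward mf1 mEpsi i1 measurableT; rewrite preimage_setT => <-.
have := integral_pushforward mf2 mEpsi i2 measurableT; rewrite preimage_setT => <-.
apply: eq_measure_integral => A mA _.
apply: (@measure_unique _ R env_space rectangles (fun _ => setT)) => //.
- exact: rectangles_setI.
- by move=> i; exists [::], (fun _ _ => setT); split=> //; apply/seteqP; split.
- by rewrite bigcup_const//; exists 0%N.
- move=> _ [S [C [mC ->]]]; rewrite /= /pushforward.
  have -> : rectangle S C = rectangle (undup S) C.
    by apply/seteqP; split=> w wC x xS; apply: wC; rewrite mem_undup in xS *.
  by apply: eqP12 => //; exact: undup_uniq.
- by move=> k; rewrite /= /pushforward preimage_setT probability_setT ltry.
Qed.

End EnvironmentSpace.

Section RandomEnvironment.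
Context (R : realType) (d : nat) dT (T : measurableType dT).
Variable om : T -> env R d.
Hypothesis mom : measurable_coords om.
Hypothesis hom : forall t, substochastic (om t).

Lemma bounded_mfun_env x e : bounded_mfun (fun t => om t x e).
Proof. by apply: (@bounded_mfun_itv _ _ _ _ 1) => // t; rewrite (hom t).1 substochastic_le1. Qed.

Lemma bounded_mfun_seq_weight x s : bounded_mfun (fun t => seq_weight (om t) x s).
Proof.
elim: s x => [|e s IHs] x /=; first exact: bounded_mfun_cst.
exact: bounded_mfunM (bounded_mfun_env x e) (IHs _).
Qed.

Lemma bounded_mfun_killed B n f x : bounded_mfun (fun t => killed B (om t) n f x).
Proof.
elim: n x => [|n IHn] x /=; first exact: bounded_mfun_cst.
apply: bounded_mfunM; first exact: bounded_mfun_cst.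
by apply: bounded_mfun_sum => e; exact: bounded_mfunM (bounded_mfun_env x e) (IHn _).
Qed.

Lemma bounded_mfun_killed_prob B n x y : bounded_mfun (fun t => killed_prob B (om t) n x y).
Proof. exact: bounded_mfun_killed. Qed.

Lemma bounded_mfun_survival B n x : bounded_mfun (fun t => survival B (om t) n x).
Proof. exact: bounded_mfun_killed. Qed.

Lemma bounded_mfun_dgreen z B x y : 0 <= z < 1 -> bounded_mfun (fun t => dgreen z B (om t) x y).
Proof.
move=> z01; apply: (@bounded_mfun_itv _ _ _ _ (1 - z)^-1); last by move=> t; exact: dgreen_itv.
apply: (measurable_fun_cvg
  (h := fun n t => series (fun k => z ^+ k * killed_prob B (om t) k x y) n)).
  by move=> n; apply: (bounded_mfun_sum _ _).1 => k; apply: bounded_mfunM;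
    [exact: bounded_mfun_cst | exact: bounded_mfun_killed_prob].
by move=> t _; exact: is_cvg_dgreen.
Qed.

End RandomEnvironment.

Section Observables.
Context (R : realType) (d : nat).
Implicit Types (w : env R d) (psi : env R d -> R).

Definition stochastic w : Prop := (forall x e, 0 <= w x e) /\ (forall x, \sum_e w x e = 1).

Lemma stochastic_substochastic w : stochastic w -> substochastic w.
Proof. by move=> [w0 w1]; split=> // x; rewrite w1. Qed.

(* The Green function only makes sense for substochastic environments: functions of the
   environment are extended to the whole of [env_space] along this retraction. *)
Definition clamp w : env R d := fun x e => `|w x e| * (Num.max 1 (\sum_e' `|w x e'|))^-1.

Lemma clamp_substochastic w : substochastic (clamp w).
Proof.
have max_gt0 x : 0 < Num.max 1 (\sum_e' `|w x e'|) by rewrite lt_max ltr01.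
split=> [x e|x]; first by rewrite mulr_ge0// invr_ge0 ltW.
by rewrite -mulr_suml ler_pdivrMr// mul1r le_max lexx orbT.
Qed.

Lemma clamp_id w : stochastic w -> clamp w = w.
Proof.
move=> [w0 w1]; apply/funext => x; apply/funext => e; rewrite /clamp.
rewrite ger0_norm//; under eq_bigr do rewrite ger0_norm//.
by rewrite w1 maxxx invr1 mulr1.
Qed.

Lemma measurable_clamp x e : measurable_fun [set: env_space R d] (fun w => clamp w x e).
Proof.
have mnorm e' : measurable_fun [set: env_space R d] (fun w => `|w x e'|).
  exact: measurableT_comp (@measurable_coord R d x e').
apply: measurable_funM => //; apply: measurable_inv_ge0 => [|w]; last by rewrite le_max ler01.
by apply: measurable_maxr; [exact: measurable_cst | exact: measurable_sum].
Qed.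

Definition observable psi : Prop := bounded_mfun (fun w : env_space R d => psi (clamp w)).

Lemma observable_env x e : observable (fun w => w x e).
Proof.
exact: (@bounded_mfun_env R d _ (env_space R d) clamp measurable_clamp clamp_substochastic).
Qed.

Lemma observable_seq_weight x s : observable (fun w => seq_weight w x s).
Proof.
exact: (@bounded_mfun_seq_weight R d _ (env_space R d) clamp measurable_clamp clamp_substochastic).
Qed.

Lemma observable_dgreen z B x y : 0 <= z < 1 -> observable (fun w => dgreen z B w x y).
Proof.
exact: (@bounded_mfun_dgreen R d _ (env_space R d) clamp measurable_clamp clamp_substochastic).
Qed.

Lemma observable_bounded_mfun psi dT (T : measurableType dT) (om : T -> env R d) :
  measurable_coords om -> (forall t, stochastic (om t)) ->
  observable psi -> bounded_mfun (fun t => psi (om t)).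
Proof.
move=> mom som /bounded_mfun_comp/(_ (@measurable_env _ _ _ _ om mom)).
by under eq_fun do rewrite clamp_id//.
Qed.

Lemma Rintegral_clamp dT (T : measurableType dT) (P : probability T R) (om : T -> env R d) psi :
  (forall t, stochastic (om t)) -> \int[P]_t psi (clamp (om t)) = \int[P]_t psi (om t).
Proof. by move=> som; apply: eq_Rintegral => t _; rewrite clamp_id. Qed.

End Observables.

Section IIDLaw.
Context (R : realType) (d : nat) dT (T : measurableType dT) (P : probability T R).
Variable om : T -> env R d.
Hypothesis som : prob_vectors om.
Hypothesis iid : iid_env P om.

Lemma prob_vectors_stochastic t : stochastic (om t).
Proof. by case: som => w0 w1; split. Qed.

Lemma prob_vectors_substochastic t : substochastic (om t).
Proof. exact/stochastic_substochastic/prob_vectors_stochastic. Qed.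

Lemma iid_env_measurable : measurable_coords om.
Proof. by case: iid. Qed.
Let mom := iid_env_measurable.

Lemma iid_rectangle S C : uniq S -> (forall x e, measurable (C x e)) ->
  P [set t | rectangle S C (om t)] =
  (\prod_(x <- S) fine (P [set t | forall e, C x e (om t 0 e)]))%:E.
Proof.
move=> uS mC; have [_ same_law indep] := iid.
rewrite -[LHS]fineK; last exact/fin_num_measure/measurable_rectangle.
by rewrite indep//; congr EFin; apply: eq_bigr => x _; rewrite same_law.
Qed.

Lemma env_shift_law x (psi : env R d -> R) : observable psi ->
  \int[P]_t psi (om t) = \int[P]_t psi (fun y => om t (x + y)).
Proof.
move=> opsi; have sshift t : stochastic (fun y => om t (x + y)).
  by have [w0 w1] := prob_vectors_stochastic t; split=> y.
rewrite -(Rintegral_clamp P psi prob_vectors_stochastic) -(Rintegral_clamp P psi sshift).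
apply: (@eq_env_law R d _ T _ T P P om (fun t y => om t (x + y)) mom _ _
  (psi \o @clamp R d) opsi) => // S C uS mC.
have -> : [set t | rectangle S C (fun y => om t (x + y))] =
    [set t | rectangle (map (+%R x) S) (fun y => C (y - x)) (om t)].
  apply/seteqP; split=> t /= tC y yS e.
    by move: yS => /mapP[u uS' ->]; rewrite addrAC subrr add0r; apply: tC.
  have := tC (x + y); rewrite addrAC subrr add0r; apply.
  exact: map_f.
have uS' : uniq (map (+%R x) S) by rewrite map_inj_uniq//; exact: addrI.
rewrite !iid_rectangle//.
congr EFin; rewrite big_map; apply: eq_bigr => y _.
by rewrite addrAC subrr add0r.
Qed.

Definition mix (A : pred (Zd d)) (w w' : env R d) : env R d :=
  fun x => if A x then w x else w' x.

Lemma mix_stochastic A w w' : stochastic w -> stochastic w' -> stochastic (mix A w w').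
Proof. by move=> [w0 w1] [w0' w1']; split=> x; rewrite /mix; case: (A x). Qed.

Lemma env_mix_law A (psi : env R d -> R) : observable psi ->
  \int[P]_t psi (om t) = \int[P]_t \int[P]_t' psi (mix A (om t) (om t')).
Proof.
move=> opsi.
have mmix : measurable_coords (fun p : T * T => mix A (om p.1) (om p.2)).
  move=> x e; rewrite /mix; case: (A x).
    exact: (measurableT_comp (mom x e) measurable_fst).
  exact: (measurableT_comp (mom x e) measurable_snd).
have smix p : stochastic (mix A (om p.1) (om p.2)).
  by apply: mix_stochastic; exact: prob_vectors_stochastic.
rewrite -(Rintegral_prod P P (observable_bounded_mfun mmix smix opsi)).
rewrite -(Rintegral_clamp P psi prob_vectors_stochastic) -(Rintegral_clamp _ psi smix).
apply: (@eq_env_law R d _ T _ _ P _ om (fun p => mix A (om p.1) (om p.2)) mom mmix _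
  (psi \o @clamp R d) opsi) => S C uS mC; rewrite iid_rectangle//.
have -> : [set p | rectangle S C (mix A (om p.1) (om p.2))] =
    [set t | rectangle [seq x <- S | A x] C (om t)] `*`
    [set t | rectangle [seq x <- S | predC A x] C (om t)].
  apply/seteqP; split=> -[t t'] /=.
    move=> tC; split=> x; rewrite mem_filter => /andP[Ax xS] e.
      by have := tC x xS e; rewrite /mix Ax.
    by have := tC x xS e; rewrite /mix (negbTE Ax).
  move=> [tC tC'] x xS e; rewrite /mix; case: ifP => Ax.
    by apply: tC; rewrite mem_filter Ax.
  by apply: tC'; rewrite mem_filter /= Ax.
have mS S' := measurable_rectangle S' mom mC.
rewrite [RHS](product_measure1E P P (mS _) (mS _)).
rewrite [RHS](congr2 mule (iid_rectangle (filter_uniq A uS) mC)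
                          (iid_rectangle (filter_uniq (predC A) uS) mC)).
by rewrite -EFinM !big_filter (bigID A).
Qed.

End IIDLaw.

(** * The drift of the annealed Green function *)

Section SingleSite.
Context (R : realType) (D : finType).
Implicit Types (a u : D -> R).

Lemma quotient_ge_linearization (x y drift mean c N : R) : 0 < x -> 0 < y -> c <= mean ->
  (drift - mean) * (x - y) <= N * x ->
  (drift - mean - N) / y + (mean - c) * (2 * y - x) / y ^+ 2 <= (drift - c) / x.
Proof.
move=> x0 y0 cmean Nx; rewrite -subr_ge0.
have -> : (drift - c) / x - ((drift - mean - N) / y + (mean - c) * (2 * y - x) / y ^+ 2) =
    (N * x - (drift - mean) * (x - y)) / (x * y) + (mean - c) * (x - y) ^+ 2 / (x * y ^+ 2).
  by field; rewrite !gt_eqF.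
apply: addr_ge0; apply: divr_ge0; first by rewrite subr_ge0.
- by rewrite mulr_ge0 ?ltW.
- by apply: mulr_ge0; rewrite ?subr_ge0 ?sqr_ge0.
- by apply: mulr_ge0; rewrite ?sqr_ge0 ?ltW.
Qed.

Lemma subr_mul_sum_le_sum_sqr a u i j : (forall e, 0 <= a e) ->
  (u i - u j) * \sum_e u e * a e <= 2 * (\sum_e u e ^+ 2) * \sum_e a e.
Proof.
move=> a0; set S := \sum_e u e ^+ 2.
have sqr_le e : u e ^+ 2 <= S by rewrite /S (bigD1 e)//= lerDl sumr_ge0// => *; exact: sqr_ge0.
rewrite mulr_sumr [leRHS]mulr_sumr; apply: ler_sum => e _; rewrite mulrA ler_wpM2r//.
have := sqr_ge0 (u i - u e); have := sqr_ge0 (u j + u e).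
by have := sqr_le e; have := sqr_le i; have := sqr_le j; nra.
Qed.

Lemma drift_quotient_ge (w p a : D -> R) (K c : R) i j :
  let x := \sum_e w e * a e in let y := \sum_e p e * a e in
  (forall e, 0 <= a e) -> 0 < x -> 0 < y -> \sum_e a e <= K * x -> c <= p i - p j ->
  (w i - w j - (p i - p j) - 2 * K * \sum_e (w e - p e) ^+ 2) / y
  + (p i - p j - c) * (2 * y - x) / y ^+ 2 <= (w i - w j - c) / x.
Proof.
move=> x y a_ge0 x0 y0 ellip hc; apply: quotient_ge_linearization => //.
have -> : w i - w j - (p i - p j) = (w i - p i) - (w j - p j) by ring.
have -> : x - y = \sum_e (w e - p e) * a e.
  by rewrite -sumrB; apply: eq_bigr => e _; rewrite mulrBl.
apply: (le_trans (subr_mul_sum_le_sum_sqr (fun e => w e - p e) i j a_ge0)).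
set S := \sum_e (w e - p e) ^+ 2.
have S_ge0 : 0 <= S by apply: sumr_ge0 => e _; exact: sqr_ge0.
by have := ler_wpM2l (mulr_ge0 (ler0n R 2) S_ge0) ellip; lra.
Qed.

Context dT (T : measurableType dT) (P : probability T R).
Variable W : D -> T -> R.
Hypothesis mW : forall e, measurable_fun setT (W e).
Hypothesis W_ge0 : forall e t, 0 <= W e t.
Hypothesis W_sum1 : forall t, \sum_e W e t = 1.

Let p e := \int[P]_t W e t.

Let bW e : bounded_mfun (W e).
Proof.
apply: (@bounded_mfun_itv _ _ _ _ 1) => // t.
by rewrite W_ge0 -(W_sum1 t) (bigD1 e)//= lerDl sumr_ge0.
Qed.

Let p_sum1 : \sum_e p e = 1.
Proof.
by rewrite -Rintegral_sum//; under eq_Rintegral do rewrite W_sum1; exact: Rintegral_cstT.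
Qed.

(* The mean x of [a] under the random vector is close to its expectation y; expanding 1/x to
   second order around y, only the variance of the vector contributes to the expectation. *)
Lemma single_site_drift_ge0 a (a0 K c : R) i j : 0 < a0 -> (forall e, a0 <= a e) -> 0 <= K ->
  {ae P, forall t, \sum_e a e <= K * \sum_e W e t * a e} ->
  c <= (p i - p j) - 2 * K * \sum_e \int[P]_t ((W e t - p e) ^+ 2) ->
  0 <= \int[P]_t ((W i t - W j t - c) / \sum_e W e t * a e).
Proof.
move=> a0_gt0 aE K0 ellip hc.
pose x t := \sum_e W e t * a e; pose y := \sum_e p e * a e.
pose S t := \sum_e (W e t - p e) ^+ 2.
have a_ge0 e : 0 <= a e by rewrite (le_trans (ltW a0_gt0)).
have mean_ge (q : D -> R) : (forall e, 0 <= q e) -> \sum_e q e = 1 -> a0 <= \sum_e q e * a e.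
  by move=> q0 q1; rewrite -[leLHS]mul1r -q1 mulr_suml ler_sum// => e _; rewrite ler_wpM2l.
have p_ge0 e : 0 <= p e by exact: Rintegral_ge0.
have xa t : a0 <= x t by exact: mean_ge.
have x0 t : 0 < x t by exact: lt_le_trans (xa t).
have y0 : 0 < y by apply: (lt_le_trans a0_gt0); exact: mean_ge.
have bx : bounded_mfun x by rewrite /x.
have bVx : bounded_mfun (fun t => (x t)^-1) by exact: (bounded_mfunV a0_gt0 xa bx).
have bS : bounded_mfun S by rewrite /S.
have Ex : \int[P]_t x t = y.
  by rewrite Rintegral_sum//; apply: eq_bigr => e _; rewrite RintegralZr.
have ES : \int[P]_t S t = \sum_e \int[P]_t ((W e t - p e) ^+ 2) by rewrite Rintegral_sum.
rewrite -ES in hc.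
have S_ge0 : 0 <= \int[P]_t S t.
  by apply: Rintegral_ge0 => t _; apply: sumr_ge0 => e _; exact: sqr_ge0.
have cmean : c <= p i - p j by have := mulr_ge0 K0 S_ge0; lra.
pose lower t := (W i t - W j t - (p i - p j) - 2 * K * S t) / y
                + (p i - p j - c) * (2 * y - x t) / y ^+ 2.
have Elower : \int[P]_t lower t = ((p i - p j - c) - 2 * K * \int[P]_t S t) / y.
  rewrite /lower RintegralD// !RintegralZr// RintegralZl// !RintegralB//.
  rewrite !Rintegral_cstT RintegralZl//.
  by rewrite Ex -/(p i) -/(p j); field; rewrite gt_eqF.
apply: (@le_trans _ _ (\int[P]_t lower t)).
  by rewrite Elower divr_ge0 ?(ltW y0)//; lra.
apply: ae_le_Rintegral; [by rewrite /lower | exact: bounded_mfunM bVx |].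
by apply: filterS ellip => t ellip_t; exact: drift_quotient_ge a_ge0 (x0 t) y0 ellip_t cmean.
Qed.

End SingleSite.

Section Directions.
Context (d : nat) (hd : (0 < d)%N).

Definition e1_up : Dir d := (Ordinal hd, true).
Definition e1_dn : Dir d := (Ordinal hd, false).

Lemma e1idx_up_or_dn (e : Dir d) : e1idx e.1 -> e = e1_up \/ e = e1_dn.
Proof.
case: e => i [] /= /eqP i0; [left | right]; congr pair; exact/val_inj.
Qed.

Lemma sum_e1_up_dn (R : realType) (F : Dir d -> R) :
  (forall e, e != e1_up -> e != e1_dn -> F e = 0) -> \sum_e F e = F e1_up + F e1_dn.
Proof.
move=> F0; rewrite (bigD1 e1_up)//= (bigD1 e1_dn)//= big1 ?addr0//.
by move=> e /andP[]; exact: F0.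
Qed.

Definition drift (R : realType) (w : env R d) y : R := w y e1_up - w y e1_dn.

Lemma observable_drift (R : realType) y : observable (fun w : env R d => drift w y).
Proof.
by apply: bounded_mfunD; [|apply: bounded_mfunN]; exact: observable_env.
Qed.

End Directions.

Section EscapeProbability.
Context (R : realType) (d : nat).
Implicit Types (w : env R d) (r : Dir d -> R).

(* If [r e] is the probability to return to [y] from [y + unitv e], this is the probability
   never to return to [y]. *)
Definition escape_prob w y r : R := 1 - \sum_e w y e * r e.

Lemma escape_prob_ge w y r z : substochastic w -> 0 <= z -> (forall e, r e <= z) ->
  1 - z <= escape_prob w y r.
Proof. by move=> hw z0 rz; rewrite lerD2l lerN2 substochastic_mean_le. Qed.

Lemma observable_escape_probV y r z : 0 <= z < 1 -> (forall e, r e <= z) ->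
  observable (fun w => (escape_prob w y r)^-1).
Proof.
move=> /andP[z0 z1] rz; apply: (@bounded_mfunV _ _ _ _ (1 - z)); first by rewrite subr_gt0.
  by move=> w; apply: escape_prob_ge => //; exact: clamp_substochastic.
apply: bounded_mfunD => //; apply: bounded_mfunN; apply: bounded_mfun_sum => e.
by apply: bounded_mfunM => //; exact: observable_env.
Qed.

End EscapeProbability.

Section AnnealedDrift.
Context (R : realType) (d : nat) dT (T : measurableType dT) (P : probability T R).
Variable om : T -> env R d.
Hypothesis hd : (0 < d)%N.
Hypothesis som : prob_vectors om.
Hypothesis iid : iid_env P om.
Hypothesis eps01 : 0 < eps_env P om < 1.

Let mom := iid_env_measurable iid.
Let stoch := prob_vectors_stochastic som.
Let substoch := prob_vectors_substochastic som.
Let bom x e : bounded_mfun (fun t => om t x e).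
Proof. exact: bounded_mfun_env. Qed.

Lemma lambda_envE : lambda_env P om = \int[P]_t om t 0 (e1_up hd) - \int[P]_t om t 0 (e1_dn hd).
Proof.
rewrite -RintegralB// /lambda_env expectation.unlock /Rintegral; congr fine.
apply: eq_integral => t _; rewrite big_mkcond (sum_e1_up_dn (hd := hd)) => [|e eu ed].
  by rewrite /e1idx.
by case: ifP => // /(e1idx_up_or_dn hd)[] ee; rewrite ee eqxx in eu ed.
Qed.

Lemma sigma_env_sqrE : sigma_env P om ^+ 2 =
  \sum_e \int[P]_t ((om t 0 e - \int[P]_t om t 0 e) ^+ 2).
Proof.
have varE e : fine (variance P (fun t => om t 0 e)) =
    \int[P]_t ((om t 0 e - \int[P]_t om t 0 e) ^+ 2).
  by rewrite /variance covariance.unlock expectation.unlock.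
rewrite /sigma_env sqr_sqrtr; first by apply: eq_bigr => e _; rewrite varE.
by apply: sumr_ge0 => e _; rewrite varE; apply: Rintegral_ge0 => t _; exact: sqr_ge0.
Qed.

Lemma ae_dist_uniform_le : {ae P, forall t e,
  `|om t 0 e - (2 * d%:R)^-1| <= eps_env P om / (4 * d%:R)}.
Proof.
pose f t : R := \big[Num.max/0]_(e : Dir d) `|om t 0 e - (2 * d%:R)^-1|.
have d0 : 0 < 4 * d%:R :> R by rewrite mulr_gt0// ltr0n.
have fin : ess_sup P (fun t => (f t)%:E) \is a fin_num.
  by move: eps01; rewrite /eps_env -/f; case: ess_sup => [r //||] /=; rewrite mulr0 ltxx.
apply: filterS (ess_sup_ge P (fun t => (f t)%:E)) => t.
rewrite -(fineK fin) lee_fin => f_le e.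
rewrite /eps_env -/f mulrAC divff ?mul1r ?gt_eqF//.
by apply: le_trans f_le; rewrite /f (bigD1 e)//= le_max lexx.
Qed.

Definition kalikow_const : R :=
  lambda_env P om - 4 * d%:R * sigma_env P om ^+ 2 * (1 + eps_env P om).

Lemma kalikow_const_le1 : kalikow_const <= 1.
Proof.
have /andP[eps0 _] := eps01.
have p_le1 : \int[P]_t om t 0 (e1_up hd) <= 1.
  rewrite -(Rintegral_cstT P 1); apply: le_Rintegral => // t _; exact: substochastic_le1.
have p_ge0 : 0 <= \int[P]_t om t 0 (e1_dn hd) by apply: Rintegral_ge0 => t _; exact: som.1.
have : 0 <= 4 * d%:R * sigma_env P om ^+ 2 * (1 + eps_env P om).
  apply: mulr_ge0; last by rewrite addr_ge0 ?ltW.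
  by apply: mulr_ge0; rewrite ?sqr_ge0 ?mulr_ge0.
by rewrite /kalikow_const lambda_envE; lra.
Qed.

Lemma origin_drift_ge0 z (r : Dir d -> R) : 0 <= z < 1 -> (forall e, 0 <= r e <= z) ->
  0 <= \int[P]_t ((drift hd (om t) 0 - kalikow_const) / escape_prob (om t) 0 r).
Proof.
move=> /andP[z0 z1] r0z; have [w0 w1] := som; have /andP[eps0 eps1] := eps01.
have dd : 0 < d%:R :> R by rewrite ltr0n.
have escapeE t : escape_prob (om t) 0 r = \sum_e om t 0 e * (1 - r e).
  by rewrite /escape_prob -{1}(w1 t 0) -sumrB; apply: eq_bigr => e _; ring.
under eq_Rintegral do rewrite escapeE.
have K0 : 0 <= 2 * d%:R * (1 + eps_env P om) by rewrite !mulr_ge0 ?addr_ge0 ?ltW.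
apply: (@single_site_drift_ge0 R (Dir d) _ T P (fun e t => om t 0 e) _ _ _
   (fun e => 1 - r e) (1 - z) (2 * d%:R * (1 + eps_env P om))) => //.
- by rewrite subr_gt0.
- by move=> e; have /andP[] := r0z e; lra.
- apply: filterS ae_dist_uniform_le => t near_uniform.
  rewrite mulr_sumr; apply: ler_sum => e _.
  rewrite mulrA -[leLHS]mul1r ler_wpM2r//; first by have /andP[] := r0z e; lra.
  have := near_uniform e; rewrite ler_norml => /andP[om_ge _].
  have {}om_ge : (2 * d%:R)^-1 - eps_env P om / (4 * d%:R) <= om t 0 e by lra.
  apply: le_trans (ler_wpM2l K0 om_ge).
  have -> : 2 * d%:R * (1 + eps_env P om) * ((2 * d%:R)^-1 - eps_env P om / (4 * d%:R)) =
     (1 + eps_env P om) * (1 - eps_env P om / 2) by field; rewrite gt_eqF.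
  by nra.
- by rewrite -lambda_envE -sigma_env_sqrE /kalikow_const; lra.
Qed.

Lemma site_drift_ge0 y z (r : Dir d -> R) : 0 <= z < 1 -> (forall e, 0 <= r e <= z) ->
  0 <= \int[P]_t ((drift hd (om t) y - kalikow_const) / escape_prob (om t) y r).
Proof.
move=> z01 r0z; apply: (le_trans (origin_drift_ge0 z01 r0z)).
have obs : observable (fun w : env R d => (drift hd w 0 - kalikow_const) / escape_prob w 0 r).
  apply: bounded_mfunM; first by apply: bounded_mfunD => //; exact: observable_drift.
  by apply: observable_escape_probV z01 _ => e; case/andP: (r0z e).
by rewrite (env_shift_law som iid y obs) /drift /escape_prob addr0.
Qed.

Lemma stop_at_mix y w w' : stop_at y (mix (predC1 y) w w') = stop_at y w :> env R d.
Proof. by apply/funext => x; apply/funext => e; rewrite /stop_at /mix /=; case: eqP. Qed.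

(* The law of the environment is unchanged when [om t y] is replaced by an independent copy; the
   Green function then depends on that copy through the escape probability only. *)
Lemma dgreen_drift_ge B x y z : 0 <= z < 1 -> y \in B ->
  kalikow_const * \int[P]_t dgreen z B (om t) x y <=
  \int[P]_t (dgreen z B (om t) x y * drift hd (om t) y).
Proof.
move=> z01 yB; have /andP[z0 z1] := z01.
have bg : bounded_mfun (fun t => dgreen z B (om t) x y) by exact: bounded_mfun_dgreen.
have bD : bounded_mfun (fun t => drift hd (om t) y) by rewrite /drift.
rewrite -subr_ge0 -RintegralZl// -RintegralB//.
have -> : \int[P]_t (dgreen z B (om t) x y * drift hd (om t) y -
      kalikow_const * dgreen z B (om t) x y) =
    \int[P]_t (dgreen z B (om t) x y * (drift hd (om t) y - kalikow_const)).
  by apply: eq_Rintegral => t _; ring.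
have obs : observable (fun w : env R d => dgreen z B w x y * (drift hd w y - kalikow_const)).
  apply: bounded_mfunM; first exact: observable_dgreen.
  by apply: bounded_mfunD => //; exact: observable_drift.
rewrite (env_mix_law som iid (predC1 y) obs); apply: Rintegral_ge0 => t _.
pose h u := dgreen z B (stop_at y (om t)) u y; pose r e := z * h (y + unitv e).
have hstop : substochastic (stop_at y (om t)) by exact: stop_at_substochastic.
have h0 u : 0 <= h u by exact: dgreen_ge0.
have r0z e : 0 <= r e <= z.
  by rewrite mulr_ge0//= ler_piMr// dgreen_stop_at_le1.
have bE : bounded_mfun (fun t' => (escape_prob (om t') y r)^-1).
  apply: (observable_bounded_mfun (psi := fun w => (escape_prob w y r)^-1) mom stoch).
  apply: observable_escape_probV z01 _ => e.
  by case/andP: (r0z e).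
have mixE t' : dgreen z B (mix (predC1 y) (om t) (om t')) x y *
      (drift hd (mix (predC1 y) (om t) (om t')) y - kalikow_const) =
    h x * ((drift hd (om t') y - kalikow_const) / escape_prob (om t') y r).
  have hmix : substochastic (mix (predC1 y) (om t) (om t')).
    by apply: stochastic_substochastic; exact: mix_stochastic.
  rewrite dgreen_first_passage// dgreen_return// stop_at_mix /drift /mix /= eqxx /=.
  rewrite -mulrA [_^-1 * _]mulrC; congr (_ * (_ / (1 - _))).
  by rewrite mulr_sumr; apply: eq_bigr => e _; rewrite /r mulrCA.
under eq_Rintegral do rewrite mixE.
by rewrite RintegralZl// mulr_ge0// (site_drift_ge0 y z01 r0z).
Qed.

End AnnealedDrift.

(** * Bounds on the annealed Green function *)

Section Level.
Context (d : nat) (hd : (0 < d)%N).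
Implicit Types x : Zd d.

Definition level x : int := x ord0 (Ordinal hd).

Lemma level0 : level 0 = 0. Proof. by rewrite /level mxE. Qed.

Lemma level_up x : level (x + unitv (e1_up hd)) = level x + 1.
Proof. by rewrite /level !mxE eqxx. Qed.

Lemma level_dn x : level (x + unitv (e1_dn hd)) = level x - 1.
Proof. by rewrite /level !mxE eqxx. Qed.

Lemma level_other x e : e != e1_up hd -> e != e1_dn hd -> level (x + unitv e) = level x.
Proof.
case: e => i b; rewrite /level !mxE /= => neq_up neq_dn.
case: eqP => [ii|]; last by rewrite addr0.
by case: b neq_up neq_dn; rewrite -ii ?eqxx.
Qed.

Lemma level_step_le x e : level (x + unitv e) <= level x + 1.
Proof.
have [->|neq_up] := eqVneq e (e1_up hd); first by rewrite level_up.
have [->|neq_dn] := eqVneq e (e1_dn hd); first by rewrite level_dn lerD2l.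
by rewrite level_other// lerDl.
Qed.

Lemma sum_level_increments (R : realType) (F : Dir d -> R) (phi : int -> R) x :
  \sum_e F e * (phi (level x) - phi (level (x + unitv e))) =
  F (e1_up hd) * (phi (level x) - phi (level x + 1)) +
  F (e1_dn hd) * (phi (level x) - phi (level x - 1)).
Proof.
rewrite (sum_e1_up_dn (hd := hd)) ?level_up ?level_dn// => e neq_up neq_dn.
by rewrite level_other// subrr mulr0.
Qed.

Lemma dotR_e1vec (R : realType) x : dotR x (e1vec R d) = (level x)%:~R.
Proof.
rewrite /dotR (bigD1 (Ordinal hd))//= mxE /e1idx /= mulr1 big1 ?addr0//.
move=> i /negP ni; rewrite mxE; case: ifP => [/eqP i0|_]; last by rewrite mulr0.
by case: ni; apply/eqP/val_inj.
Qed.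

End Level.

Section Barrier.
Context (R : realType).
Implicit Types (c : R) (k : int).

Definition barrier c k : R := if k is Posz n then (1 - c) ^+ n else 1.

Lemma barrier_itv c k : 0 <= c <= 1 -> 0 <= barrier c k <= 1.
Proof.
move=> /andP[c0 c1]; case: k => n /=; last by rewrite ler01 lexx.
by rewrite exprn_ge0 ?exprn_ile1 ?subr_ge0// gerBl.
Qed.

Lemma barrier_le0 c k : k <= 0 -> barrier c k = 1.
Proof. by case: k => // -[|n]. Qed.

Lemma barrier_superharmonic c (up dn mass : R) k : 0 <= c <= 1 -> 0 <= dn -> up <= mass ->
  c * mass <= up - dn ->
  c * c * (k == 0)%:R * mass <=
  up * (barrier c k - barrier c (k + 1)) + dn * (barrier c k - barrier c (k - 1)).
Proof.
move=> /andP[c0 c1] dn0 up_mass drift.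
have c_up : c * up <= c * mass by rewrite ler_wpM2l.
case: k => [[|n]|n].
- rewrite eqxx mulr1 add0r sub0r /= expr0 expr1.
  have : c * (c * mass) <= c * (up - dn) by rewrite ler_wpM2l.
  by have := mulr_ge0 c0 dn0; lra.
- have -> : Posz n.+1 + 1 = Posz n.+2 by lia.
  have -> : Posz n.+1 - 1 = Posz n by lia.
  rewrite mulr0 mul0r /= !exprS.
  have -> : up * ((1 - c) * (1 - c) ^+ n - (1 - c) * ((1 - c) * (1 - c) ^+ n))
    + dn * ((1 - c) * (1 - c) ^+ n - (1 - c) ^+ n) =
    (1 - c) ^+ n * c * (up * (1 - c) - dn) by ring.
  by rewrite !mulr_ge0// ?exprn_ge0 ?subr_ge0//; lra.
- rewrite mulr0 mul0r !barrier_le0; [|lia..].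
  by rewrite subrr !mulr0 addr0.
Qed.

End Barrier.

Section AnnealedGreen.
Context (R : realType) (d : nat) dT (T : measurableType dT) (P : probability T R).
Variable om : T -> env R d.

Definition annealed_green z B y : R := \int[P]_t dgreen z B (om t) 0 y.

Definition annealed_flow z B y e : R := \int[P]_t (dgreen z B (om t) 0 y * om t y e).

Hypothesis hd : (0 < d)%N.
Hypothesis som : prob_vectors om.
Hypothesis iid : iid_env P om.
Hypothesis eps01 : 0 < eps_env P om < 1.
Hypothesis kalikow_gt0 : 0 < kalikow_const P om.
Let c := kalikow_const P om.
Let lev := level hd.
Let substoch := prob_vectors_substochastic som.
Let mom := iid_env_measurable iid.

Let c01 : 0 <= c <= 1.
Proof. by rewrite ltW//= (kalikow_const_le1 hd som iid eps01). Qed.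

Variables (B : set (Zd d)) (z : R).
Hypothesis z01 : 0 <= z < 1.
Let G y := annealed_green z B y.
Let F y e := annealed_flow z B y e.

Let z_ge0 : 0 <= z. Proof. by case/andP: z01. Qed.

Let bg y : bounded_mfun (fun t => dgreen z B (om t) 0 y).
Proof. exact: bounded_mfun_dgreen. Qed.

Let bflow y e : bounded_mfun (fun t => dgreen z B (om t) 0 y * om t y e).
Proof. by apply: bounded_mfunM => //; exact: bounded_mfun_env. Qed.

Lemma annealed_flow_ge0 y e : 0 <= annealed_flow z B y e.
Proof. by apply: Rintegral_ge0 => t _; rewrite mulr_ge0 ?dgreen_ge0 ?(substoch t).1. Qed.

Lemma annealed_green_sum_flow y : annealed_green z B y = \sum_e annealed_flow z B y e.
Proof.
by rewrite -Rintegral_sum//; apply: eq_Rintegral => t _; rewrite -mulr_sumr som.2 mulr1.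
Qed.

Let G_ge0 y : 0 <= G y.
Proof. by rewrite /G annealed_green_sum_flow sumr_ge0// => e _; exact: annealed_flow_ge0. Qed.

Lemma annealed_flow_notin y e : y \notin B -> annealed_flow z B y e = 0.
Proof.
move=> yB; rewrite /annealed_flow; under eq_Rintegral do rewrite dgreen_notin// mul0r.
exact: Rintegral_cstT.
Qed.

Lemma annealed_flow_drift y :
  c * annealed_green z B y <= annealed_flow z B y (e1_up hd) - annealed_flow z B y (e1_dn hd).
Proof.
have [yB|yB] := boolP (y \in B); last first.
  by rewrite annealed_green_sum_flow big1 ?annealed_flow_notin ?mulr0 ?subrr// => e _;
    rewrite annealed_flow_notin.
rewrite -RintegralB//; apply: (le_trans (dgreen_drift_ge hd som iid eps01 0 z01 yB)).
apply: le_Rintegral => // [|t _]; last by rewrite mulrBr.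
by under eq_fun do rewrite /drift mulrBr.
Qed.

Lemma barrier_flow_ge l y :
  c * c * (lev y == l)%:R * G y <=
  \sum_e F y e * (barrier c (lev y - l) - barrier c (lev (y + unitv e) - l)).
Proof.
rewrite (sum_level_increments hd (F y) (fun k => barrier c (k - l))) -/lev.
rewrite (addrAC _ 1) (addrAC _ (-1)) -subr_eq0.
apply: barrier_superharmonic; rewrite ?annealed_flow_ge0 ?annealed_flow_drift//.
rewrite /G annealed_green_sum_flow (bigD1 (e1_up hd))//= lerDl.
by rewrite sumr_ge0// => e _; exact: annealed_flow_ge0.
Qed.

Variable r : seq (Zd d).
Hypothesis r_uniq : uniq r.
Hypothesis B_sub_r : forall y, B y -> y \in r.
Hypothesis B0 : B 0.

Lemma annealed_dynkin (f : Zd d -> R) :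
  \sum_(y <- r) (G y * f y - z * \sum_e F y e * ((y + unitv e \in B)%:R * f (y + unitv e))) = f 0.
Proof.
pose term t y := dgreen z B (om t) 0 y * f y -
  z * \sum_e dgreen z B (om t) 0 y * om t y e * ((y + unitv e \in B)%:R * f (y + unitv e)).
have bterm y : bounded_mfun (term^~ y) by rewrite /term.
transitivity (\int[P]_t \sum_(y <- r) term t y).
  rewrite Rintegral_sum//; apply: eq_bigr => y _.
  rewrite RintegralB// RintegralZr// RintegralZl// Rintegral_sum//.
  by congr (_ - _ * _); apply: eq_bigr => e _; rewrite RintegralZr.
rewrite -[RHS](Rintegral_cstT P); apply: eq_Rintegral => t _.
have := dgreen_dynkin z01 0 f (substoch t) r_uniq B_sub_r.
rewrite (mem_set B0) mul1r => <-.
apply: eq_bigr => y _; rewrite /term mulrBr; congr (_ - _).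
rewrite [RHS]mulrCA [X in _ = _ * X]mulr_sumr; congr (_ * _).
by apply: eq_bigr => e _; rewrite -mulrA.
Qed.

Lemma annealed_potential_le (f : Zd d -> R) : (forall y, y \in B -> 0 <= f y) ->
  z * \sum_(y <- r) \sum_e F y e * (f y - (y + unitv e \in B)%:R * f (y + unitv e)) <= f 0.
Proof.
move=> f0; rewrite -annealed_dynkin mulr_sumr; apply: ler_sum => y _.
under eq_bigr do rewrite mulrBr.
rewrite sumrB -mulr_suml -annealed_green_sum_flow -/(G y) mulrBr lerD2r.
have [yB|yB] := boolP (y \in B).
  by rewrite ler_piMl ?mulr_ge0 ?f0// ltW//; case/andP: z01.
by rewrite /G annealed_green_sum_flow big1 ?mul0r ?mulr0// => e _; rewrite annealed_flow_notin.
Qed.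

Lemma flow_killed_increments_ge (f : Zd d -> R) y :
  (forall e, y \in B -> y + unitv e \notin B -> 0 <= f (y + unitv e)) ->
  \sum_e F y e * (f y - f (y + unitv e)) <=
  \sum_e F y e * (f y - (y + unitv e \in B)%:R * f (y + unitv e)).
Proof.
move=> f0; apply: ler_sum => e _; have [yB|yB] := boolP (y \in B); last first.
  by rewrite /F annealed_flow_notin// !mul0r.
rewrite ler_wpM2l ?annealed_flow_ge0// lerD2l lerN2.
by have [eB|eB] := boolP (y + unitv e \in B); rewrite ?mul1r// mul0r f0.
Qed.

Lemma annealed_green_le y : z * (c * c * annealed_green z B y) <= 1.
Proof.
have [yB|yB] := boolP (y \in B); last first.
  by rewrite annealed_green_sum_flow big1 ?mulr0// => e _; rewrite annealed_flow_notin.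
pose f u := barrier c (lev u - lev y).
have f_itv u : 0 <= f u <= 1 by exact: barrier_itv.
have f_ge0 u : 0 <= f u by case/andP: (f_itv u).
apply: (@le_trans _ _ (f 0)); last by case/andP: (f_itv 0).
apply: le_trans (annealed_potential_le (fun u _ => f_ge0 u)); rewrite ler_wpM2l//.
have term_ge u : c * c * (lev u == lev y)%:R * G u <=
    \sum_e F u e * (f u - (u + unitv e \in B)%:R * f (u + unitv e)).
  exact: le_trans (barrier_flow_ge _ _) (flow_killed_increments_ge _).
apply: (@le_trans _ _ (\sum_(u <- r) c * c * (lev u == lev y)%:R * G u)); last exact: ler_sum.
rewrite (bigD1_seq y) ?B_sub_r//=; last exact/set_mem.
rewrite eqxx mulr1 lerDl sumr_ge0// => u _.
by rewrite !mulr_ge0 ?(ltW kalikow_gt0).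
Qed.

Lemma annealed_time_le (L : nat) : (forall x, B x -> lev x < L%:Z) ->
  z * (c * \sum_(y <- r) annealed_green z B y) <= L%:R.
Proof.
move=> BL; pose f u : R := L%:R - (lev u)%:~R.
have f_ge0 u : lev u <= L%:Z -> 0 <= f u by rewrite /f subr_ge0 -[L%:R]/(L%:Z%:~R) ler_int.
have <- : f 0 = L%:R by rewrite /f /lev level0 subr0.
apply: le_trans (annealed_potential_le (f := f) _); last first.
  by move=> y /set_mem/BL/ltW; exact: f_ge0.
rewrite ler_wpM2l// mulr_sumr ler_sum// => u _.
apply: le_trans (flow_killed_increments_ge (f := f) _) => [|e uB _]; last first.
  by apply: f_ge0; rewrite (le_trans (level_step_le hd u e))// lezD1; exact/BL/set_mem.
rewrite (sum_level_increments hd (F u) (fun k => L%:R - k%:~R)).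
by apply: (le_trans (annealed_flow_drift u)); rewrite -/(F _ _) -/(F _ _) !intrD; lra.
Qed.

Lemma annealed_exit_le : (forall x, B x -> 0 <= lev x) ->
  z * \sum_(y <- r) \sum_e F y e * (lev (y + unitv e) < 0)%R%:R <= 1 - c.
Proof.
move=> B_ge0; pose f u := barrier c (lev u - (-1)).
have f_ge0 u : 0 <= f u by case/andP: (barrier_itv (lev u - (-1)) c01).
have <- : f 0 = 1 - c by rewrite /f /lev level0.
apply: le_trans (annealed_potential_le (fun u _ => f_ge0 u)).
rewrite ler_wpM2l// ler_sum// => u _.
have superharmonic : 0 <= \sum_e F u e * (f u - f (u + unitv e)).
  apply: le_trans (barrier_flow_ge (-1) u).
  by rewrite !mulr_ge0 ?(ltW kalikow_gt0).
rewrite -[leLHS]add0r; apply: (le_trans (lerD superharmonic (lexx _))).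
rewrite -big_split ler_sum//= => e _; rewrite -mulrDr ler_wpM2l ?annealed_flow_ge0//.
case: ltP => [below|_]; last first.
  by rewrite addr0 lerD2l lerN2 ler_piMl// lern1 leq_b1.
have eB : u + unitv e \notin B.
  by apply: contraL below => /set_mem/B_ge0; rewrite leNgt.
by rewrite (negbTE eB) mul0r /f [barrier c (_ (u + _) - _)]barrier_le0 ?subr0 ?subrK// opprK lezD1.
Qed.

End AnnealedGreen.

(** * Kalikow's condition *)

Section Discounting.
Context (R : realType).

Lemma le_of_discounted (S C : R) k :
  (forall z : R, 0 < z < 1 -> z ^+ k * S <= C) -> S <= C.
Proof.
move=> zS; pose z n : R := 1 - n.+2%:R^-1.
have z_cvg1 : z @ \oo --> (1 : R).
  rewrite -[X in _ --> X]subr0; apply: cvgB; first exact: cvg_cst.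
  by have := @cvg_harmonic R; rewrite -cvg_shiftS.
have zX_cvg1 j : (fun n => z n ^+ j) @ \oo --> (1 : R).
  elim: j => [|j IHj]; first by under eq_fun do rewrite expr0; exact: cvg_cst.
  by rewrite -[X in _ --> X]mul1r; under eq_fun do rewrite exprS; exact: cvgM z_cvg1 IHj.
have zXS_cvg : (fun n => z n ^+ k * S) @ \oo --> S.
  by rewrite -[X in _ --> X]mul1r; exact: cvgM (zX_cvg1 k) (cvg_cst _).
rewrite -(cvg_lim _ zXS_cvg)//; apply: limr_le; first exact: cvgP zXS_cvg.
apply: nearW => n; apply: zS.
by rewrite subr_gt0 invf_lt1 ?ltr0n// ltr1n /= gtrBl invr_gt0 ltr0n.
Qed.

Lemma discounted_sum_ge (u : nat -> R) z k : 0 <= z < 1 -> (forall n, 0 <= u n) ->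
  z ^+ k * \sum_(n < k) u n <= \sum_(n < k) z ^+ n * u n.
Proof.
move=> /andP[z0 z1] u0; rewrite mulr_sumr; apply: ler_sum => n _.
by rewrite ler_wpM2r// ler_wiXn2l ?(ltW z1)// ltnW.
Qed.

End Discounting.

Section AnnealedWalk.
Context (R : realType) (d : nat) dT (T : measurableType dT) (P : probability T R).
Variable om : T -> env R d.
Hypothesis hd : (0 < d)%N.
Hypothesis som : prob_vectors om.
Hypothesis iid : iid_env P om.
Hypothesis eps01 : 0 < eps_env P om < 1.
Hypothesis kalikow_gt0 : 0 < kalikow_const P om.
Let c := kalikow_const P om.
Let lev := level hd.
Let substoch := prob_vectors_substochastic som.
Let mom := iid_env_measurable iid.

Let bom x e : bounded_mfun (fun t => om t x e).
Proof. exact: bounded_mfun_env. Qed.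

Let bkilled B n x y : bounded_mfun (fun t => killed_prob B (om t) n x y).
Proof. exact: bounded_mfun_killed_prob. Qed.

Let bsurvival B n x : bounded_mfun (fun t => survival B (om t) n x).
Proof. exact: bounded_mfun_survival. Qed.

Let bdgreen z B x y : 0 <= z < 1 -> bounded_mfun (fun t => dgreen z B (om t) x y).
Proof. exact: bounded_mfun_dgreen. Qed.

Lemma sum_killed_prob_le_dgreen B x y z k (v : T -> R) : 0 <= z < 1 -> bounded_mfun v ->
  (forall t, 0 <= v t) ->
  \sum_(n < k) z ^+ n * \int[P]_t (killed_prob B (om t) n x y * v t) <=
  \int[P]_t (dgreen z B (om t) x y * v t).
Proof.
move=> z01 bv v0; have bg := bdgreen B x y z01.
under eq_bigr do rewrite -RintegralZl//.
rewrite -Rintegral_sum//; apply: le_Rintegral => // t _.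
by under eq_bigr do rewrite mulrA; rewrite -mulr_suml ler_wpM2r ?dgreen_ge_partial.
Qed.

Lemma sum_killed_prob_le_annealed_green B y z k : 0 <= z < 1 ->
  \sum_(n < k) z ^+ n * \int[P]_t killed_prob B (om t) n 0 y <= annealed_green P om z B y.
Proof.
move=> z01; have := sum_killed_prob_le_dgreen B 0 y k z01 (bounded_mfun_cst T 1) (fun=> ler01).
by under eq_Rintegral do rewrite mulr1; under eq_bigr do
  (under eq_Rintegral do rewrite mulr1).
Qed.

Lemma annealed_killed_prob_sum_le B y k : B 0 ->
  \sum_(n < k) \int[P]_t killed_prob B (om t) n 0 y <= (c * c)^-1.
Proof.
move=> B0; have cc : 0 < c * c by rewrite mulr_gt0.
apply: (@le_of_discounted _ _ _ k.+1) => z /andP[z0 z1].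
have z01 : 0 <= z < 1 by rewrite ltW.
have B'0 : truncation B k 0 by exact: origin_in_truncation.
rewrite -[leRHS]mul1r ler_pdivlMr// mulrC.
apply: le_trans (annealed_green_le hd som iid eps01 kalikow_gt0 z01 (reach_uniq d k)
  (@truncation_sub_reach _ B k) B'0 y).
rewrite [leRHS]mulrCA ler_wpM2l ?(ltW cc)// exprS -mulrA ler_wpM2l ?(ltW z0)//.
have killed_ge0 n : 0 <= \int[P]_t killed_prob B (om t) n 0 y.
  by apply: Rintegral_ge0 => t _; exact: killed_prob_ge0.
apply: (le_trans (discounted_sum_ge k z01 killed_ge0)).
apply: (le_trans _ (sum_killed_prob_le_annealed_green _ y k z01)).
apply: ler_sum => n _; rewrite /killed_prob.
by under [in leRHS]eq_Rintegral do rewrite (killed_truncation_origin _ _ _ (ltnW (ltn_ord n))).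
Qed.

Lemma annealed_time_sum_le (L k : nat) : (0 < L)%N ->
  \sum_(n < k) \int[P]_t survival [set x | lev x < L%:Z] (om t) n 0 <= L%:R / c.
Proof.
move=> L0; set B := [set x | lev x < L%:Z].
have B'0 : truncation B k 0 by apply: origin_in_truncation; rewrite /B /= /lev level0.
apply: (@le_of_discounted _ _ _ k.+1) => z /andP[z0 z1].
have z01 : 0 <= z < 1 by rewrite ltW.
have B'L x : truncation B k x -> lev x < L%:Z by case.
rewrite ler_pdivlMr// mulrC.
apply: le_trans (annealed_time_le som iid eps01 z01 (reach_uniq d k)
  (@truncation_sub_reach _ B k) B'0 B'L).
rewrite [leRHS]mulrCA ler_wpM2l ?(ltW kalikow_gt0)// exprS -mulrA ler_wpM2l ?(ltW z0)//.
have survival_ge0 n : 0 <= \int[P]_t survival B (om t) n 0.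
  by apply: Rintegral_ge0 => t _; case/andP: (survival_itv B n 0 (substoch t)).
apply: (le_trans (discounted_sum_ge k z01 survival_ge0)).
have survivalE (n : 'I_k) : \int[P]_t survival B (om t) n 0 =
    \sum_(y <- reach d k) \int[P]_t killed_prob (truncation B k) (om t) n 0 y.
  rewrite -Rintegral_sum//; apply: eq_Rintegral => t _.
  rewrite /survival -(killed_truncation_origin _ _ _ (ltnW (ltn_ord n))).
  rewrite (killed_sum_prob _ _ _ _ (reach_uniq d k) (@truncation_sub_reach _ B k)).
  by apply: eq_bigr => y _; rewrite mulr1.
under eq_bigr => n _ do rewrite survivalE mulr_sumr.
by rewrite exchange_big; apply: ler_sum => y _; exact: sum_killed_prob_le_annealed_green.
Qed.

Lemma annealed_survival_ge n :
  c <= \int[P]_t survival [set x | 0 <= lev x] (om t) n 0.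
Proof.
set B := [set x | 0 <= lev x].
have B0 : B 0 by rewrite /B /= /lev level0.
have notinB x : (x \notin B) = (lev x < 0).
  by rewrite ltNge; congr (~~ _); apply/idP/idP => [/set_mem//|x0]; exact/mem_set.
suff : 1 - \int[P]_t survival B (om t) n 0 <= 1 - c by lra.
apply: (@le_of_discounted _ _ _ n) => z /andP[z0 z1].
have z01 : 0 <= z < 1 by rewrite ltW.
have B'0 : truncation B n 0 by exact: origin_in_truncation.
have B'_ge0 x : truncation B n x -> 0 <= lev x by case.
apply: le_trans (annealed_exit_le som iid eps01 kalikow_gt0 z01 (reach_uniq d n)
  (@truncation_sub_reach _ B n) B'0 B'_ge0).
have bg y := bdgreen (truncation B n) 0 y z01.
rewrite -[X in X - _](Rintegral_cstT P) -RintegralB// -RintegralZl// mulr_sumr.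
under eq_bigr do rewrite mulr_sumr.
under eq_bigr do under eq_bigr do rewrite -RintegralZr// -RintegralZl//.
under eq_bigr do rewrite -Rintegral_sum//; rewrite -Rintegral_sum//.
apply: le_Rintegral => // t _.
have r0 : 0 \in reach d 0 by rewrite inE.
have nn : (n + 0 <= n)%N by rewrite addn0.
apply: (le_trans (discounted_exit_prob_le z01 (substoch t) (som.2 t) r0 nn (mem_set B0))).
apply: ler_sum => y _; rewrite !mulr_sumr; apply: ler_sum => e _.
by rewrite notinB mulrCA -[X in _ <= _ * X]mulrA.
Qed.

End AnnealedWalk.

Section Ellipticity.
Context (R : realType) (d : nat) dT (T : measurableType dT) (P : probability T R).
Variable om : T -> env R d.
Hypothesis iid : iid_env P om.

Lemma ae_site_shift (C : Dir d -> set R) x : (forall e, measurable (C e)) ->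
  {ae P, forall t e, C e (om t 0 e)} -> {ae P, forall t e, C e (om t x e)}.
Proof.
move=> mC ae0; have [mom same_law _] := iid.
have mE u : measurable [set t | forall e, C e (om t u e)].
  have := measurable_rectangle [:: u] mom (fun _ e => mC e).
  congr measurable; apply/seteqP; split=> t /= tC; last first.
    by move=> v; rewrite inE => /eqP ->.
  by move=> e; apply: tC; rewrite inE.
have full0 : P (~` [set t | forall e, C e (om t 0 e)]) = 0%E.
  exact/(negligibleP _ (measurableC (mE 0))).
apply/(negligibleP _ (measurableC (mE x))).
by rewrite [LHS](probability_setC P (mE x)) same_law// -(probability_setC P (mE 0)).
Qed.

Hypothesis hd : (0 < d)%N.
Hypothesis eps01 : 0 < eps_env P om < 1.

Lemma ae_elliptic x : {ae P, forall t e, (4 * d%:R)^-1 <= om t x e}.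
Proof.
have d0 : 0 < d%:R :> R by rewrite ltr0n.
apply: (@ae_site_shift (fun=> [set u | (4 * d%:R)^-1 <= u])).
  by move=> _; rewrite -set_itvcy.
apply: filterS (ae_dist_uniform_le hd eps01) => t near_uniform e /=.
have := near_uniform e; rewrite ler_norml => /andP[om_ge _]; have /andP[_ eps1] := eps01.
have eps_le : eps_env P om / (4 * d%:R) <= (4 * d%:R)^-1.
  by rewrite ler_pdivrMr ?mulr_gt0// mulVf ?gt_eqF ?mulr_gt0// ltW.
have half : (2 * d%:R)^-1 = (4 * d%:R)^-1 + (4 * d%:R)^-1 :> R by field; rewrite gt_eqF.
by rewrite half in om_ge; lra.
Qed.

Lemma ae_seq_weight_ge x s : {ae P, forall t, (4 * d%:R)^-1 ^+ size s <= seq_weight (om t) x s}.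
Proof.
have d0 : 0 <= (4 * d%:R)^-1 :> R by rewrite invr_ge0 mulr_ge0.
elim: s x => [|e s IHs] x /=; first by apply: aeW => t; rewrite expr0.
apply: filterS2 (ae_elliptic x) (IHs (x + unitv e)) => t om_ge s_ge.
by rewrite exprS ler_pM// exprn_ge0.
Qed.

Lemma annealed_killed_prob_gt0 B y : prob_vectors om -> nn_connected B -> B 0 -> B y ->
  exists n, 0 < \int[P]_t killed_prob B (om t) n 0 y.
Proof.
move=> som connB B0 By; have [n [s [sB sy]]] := connB 0 y B0 By; exists n.
have substoch := prob_vectors_substochastic som; have mom := iid_env_measurable iid.
have d0 : 0 < (4 * d%:R)^-1 :> R by rewrite invr_gt0 mulr_gt0// ltr0n.
have [g _ gK] := ffun_tuple_bij d n; pose u := g s.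
have uB : inside B 0 u.
  by rewrite -inside_ffun_tuple gK; apply/forallP => k; exact/mem_set.
have uy : endpoint 0 u = y.
  by rewrite -sy -[s]gK pos_ffun_tuple take_oversize// size_tuple.
apply: (lt_le_trans (exprn_gt0 n d0)); rewrite -[leLHS](Rintegral_cstT P).
apply: ae_le_Rintegral => //; first exact: bounded_mfun_killed_prob.
apply: filterS (ae_seq_weight_ge 0 u) => t; rewrite size_tuple => /le_trans; apply.
rewrite /killed_prob -killed_tupleE (bigD1 u)//= uy eqxx mulr1 lerDl sumr_ge0// => v _.
by rewrite mulr_ge0//; case/andP: (seq_weight_itv 0 v (substoch t)).
Qed.

End Ellipticity.

Section KalikowCondition.
Context (R : realType) (d : nat) dT (T : measurableType dT) (P : probability T R).
Variable om : T -> env R d.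
Hypothesis hd : (0 < d)%N.
Hypothesis som : prob_vectors om.
Hypothesis iid : iid_env P om.
Hypothesis eps01 : 0 < eps_env P om < 1.
Hypothesis kalikow_gt0 : 0 < kalikow_const P om.
Let c := kalikow_const P om.
Let substoch := prob_vectors_substochastic som.
Let mom := iid_env_measurable iid.

Let bom x e : bounded_mfun (fun t => om t x e).
Proof. exact: bounded_mfun_env. Qed.

Let bkilled B n x y : bounded_mfun (fun t => killed_prob B (om t) n x y).
Proof. exact: bounded_mfun_killed_prob. Qed.

Lemma measurable_green B x y : measurable_fun setT (fun t => green B x y (om t)).
Proof.
under eq_fun do rewrite greenE.
apply: ge0_emeasurable_sum => n *; first by rewrite lee_fin killed_prob_ge0.
by apply/measurable_EFinP; exact: (bkilled B n x y).1.
Qed.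

Lemma integral_greenM B x y (v : T -> R) : bounded_mfun v -> (forall t, 0 <= v t) ->
  (\int[P]_t (green B x y (om t) * (v t)%:E) =
   \sum_(0 <= n <oo) (\int[P]_t (killed_prob B (om t) n x y * v t)%R)%:E)%E.
Proof.
move=> bv v0; under eq_integral => t _.
  rewrite greenE muleC -nneseriesZl//; last by move=> n _; rewrite lee_fin killed_prob_ge0.
  over.
have bkv n : bounded_mfun (fun t => v t * killed_prob B (om t) n x y) by [].
rewrite integral_nneseries//.
- apply: eq_eseriesr => n _; rewrite EFin_Rintegral//.
  by apply: eq_integral => t _; rewrite -EFinM mulrC.
- by move=> n; under eq_fun do rewrite -EFinM; apply/measurable_EFinP; exact: (bkv n).1.
- by move=> n t _; rewrite -EFinM lee_fin mulr_ge0 ?killed_prob_ge0.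
Qed.

Lemma integral_greenE B x y :
  (\int[P]_t green B x y (om t) =
   \sum_(0 <= n <oo) (\int[P]_t killed_prob B (om t) n x y)%R%:E)%E.
Proof.
have := integral_greenM B x y (bounded_mfun_cst T 1) (fun=> ler01).
under eq_integral do rewrite mule1; move=> ->; apply: eq_eseriesr => n _.
by under eq_Rintegral do rewrite mulr1.
Qed.

Lemma integral_green_le B y : B 0 ->
  (\int[P]_t green B 0%R y (om t) <= ((c * c)^-1)%:E)%E.
Proof.
move=> B0; rewrite integral_greenE; apply: nneseries_le_ub => [n|k].
  by apply: Rintegral_ge0 => t _; exact: killed_prob_ge0.
exact: (annealed_killed_prob_sum_le hd som iid eps01).
Qed.

Lemma integral_green_gt0 B y : nn_connected B -> B 0 -> B y ->
  (0 < \int[P]_t green B 0%R y (om t))%E.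
Proof.
move=> connB B0 By; rewrite integral_greenE.
have [n kn] := annealed_killed_prob_gt0 iid hd eps01 som connB B0 By.
have k0 m : 0 <= \int[P]_t killed_prob B (om t) m 0 y.
  by apply: Rintegral_ge0 => t _; exact: killed_prob_ge0.
apply: lt_le_trans (nneseries_ge_partial n.+1 k0); rewrite lte_fin (lt_le_trans kn)//.
by rewrite big_ord_recr /= lerDr sumr_ge0.
Qed.

Lemma integral_green_fin_num B y : B 0 -> (\int[P]_t green B 0%R y (om t))%E \is a fin_num.
Proof.
move=> B0; rewrite ge0_fin_numE; last by apply: integral_ge0 => t _; exact: green_ge0.
exact: le_lt_trans (integral_green_le y B0) (ltry _).
Qed.

(* Monotone convergence as the discount z tends to 1. *)
Lemma integral_greenM_le B x y (v : T -> R) (C : R) : bounded_mfun v -> (forall t, 0 <= v t) ->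
  (forall z : R, 0 <= z < 1 -> \int[P]_t (dgreen z B (om t) x y * v t) <= C) ->
  (\int[P]_t (green B x y (om t) * (v t)%:E) <= C%:E)%E.
Proof.
move=> bv v0 dC; rewrite integral_greenM//.
have kv0 n : 0 <= \int[P]_t (killed_prob B (om t) n x y * v t).
  by apply: Rintegral_ge0 => t _; rewrite mulr_ge0 ?killed_prob_ge0.
apply: nneseries_le_ub => // k; apply: (@le_of_discounted _ _ _ k) => z /andP[z0 z1].
have z01 : 0 <= z < 1 by rewrite ltW.
apply: (le_trans (discounted_sum_ge k z01 kv0)).
by apply: le_trans (dC z z01); exact: sum_killed_prob_le_dgreen.
Qed.

Lemma dgreenM_le_integral_greenM B x y z (v : T -> R) : 0 <= z < 1 -> bounded_mfun v ->
  (forall t, 0 <= v t) ->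
  ((\int[P]_t (dgreen z B (om t) x y * v t))%:E <= \int[P]_t (green B x y (om t) * (v t)%:E))%E.
Proof.
move=> z01 bv v0; have bg := bounded_mfun_dgreen mom substoch B x y z01.
rewrite EFin_Rintegral//; apply: ge0_le_integral => //.
- by move=> t _; rewrite lee_fin mulr_ge0 ?dgreen_ge0.
- by apply/measurable_EFinP; exact: (bounded_mfunM bg bv).1.
- by apply: emeasurable_funM; [exact: measurable_green | apply/measurable_EFinP; exact: bv.1].
- by move=> t _; rewrite EFinM lee_wpmul2r ?dgreen_le_green// lee_fin.
Qed.

Lemma integral_greenM_fin_num B y (v : T -> R) : B 0 -> bounded_mfun v ->
  (forall t, 0 <= v t <= 1) -> (\int[P]_t (green B 0%R y (om t) * (v t)%:E))%E \is a fin_num.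
Proof.
move=> B0 bv v01; have v0 t : 0 <= v t by case/andP: (v01 t).
have gv0 t : (0 <= green B 0%R y (om t) * (v t)%:E)%E by rewrite mule_ge0 ?lee_fin ?green_ge0.
rewrite ge0_fin_numE; last exact: integral_ge0.
have := integral_green_fin_num y B0; rewrite ge0_fin_numE; last first.
  by apply: integral_ge0 => t _; exact: green_ge0.
apply: le_lt_trans; apply: ge0_le_integral => //.
- by apply: emeasurable_funM; [exact: measurable_green | apply/measurable_EFinP; exact: bv.1].
- exact: measurable_green.
- by move=> t _; rewrite -[leRHS]mule1 lee_wpmul2l ?green_ge0// lee_fin; case/andP: (v01 t).
Qed.

Lemma integral_green_drift_ge B y : B 0 -> B y ->
  (\int[P]_t (green B 0%R y (om t) * (om t y (e1_dn hd) + c)%:E) <=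
   \int[P]_t (green B 0%R y (om t) * (om t y (e1_up hd))%:E))%E.
Proof.
move=> B0 By; have om0 e t : 0 <= om t y e by exact: (substoch t).1.
have up_fin : (\int[P]_t (green B 0%R y (om t) * (om t y (e1_up hd))%:E))%E \is a fin_num.
  by apply: integral_greenM_fin_num => // t; rewrite om0 substochastic_le1.
rewrite -(fineK up_fin); apply: integral_greenM_le => // [t|z z01].
  by rewrite addr_ge0 ?(ltW kalikow_gt0).
rewrite -lee_fin (fineK up_fin).
apply: le_trans (dgreenM_le_integral_greenM B 0 y z01 (bom y (e1_up hd)) (om0 _)).
rewrite lee_fin; have bg := bounded_mfun_dgreen mom substoch B 0 y z01.
under eq_Rintegral do rewrite mulrDr.
rewrite RintegralD// RintegralZr// mulrC addrC -lerBrDr -RintegralB//.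
apply: (le_trans (dgreen_drift_ge hd som iid eps01 0 z01 (mem_set By))).
by under eq_Rintegral do rewrite /drift mulrBr.
Qed.

Lemma kalikow_env_drift_ge B y : nn_connected B -> B 0 -> B y ->
  c <= kalikow_env P om B 0 y (e1_up hd) - kalikow_env P om B 0 y (e1_dn hd).
Proof.
move=> connB B0 By; rewrite /kalikow_env.
have om0 e t : 0 <= om t y e by exact: (substoch t).1.
have om_fin e : (\int[P]_t (green B 0%R y (om t) * (om t y e)%:E))%E \is a fin_num.
  by apply: integral_greenM_fin_num => // t; rewrite om0 substochastic_le1.
have green_fin := integral_green_fin_num y B0.
have green_gt0 : 0 < fine (\int[P]_t green B 0%R y (om t))%E.
  by rewrite -lte_fin fineK// integral_green_gt0.
rewrite -mulrBl ler_pdivlMr// lerBrDr addrC -lee_fin EFinD EFinM !fineK//.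
apply: le_trans (integral_green_drift_ge B0 By).
have c0 := ltW kalikow_gt0; have mg := measurable_green B 0 y.
have g0 t : (0 <= green B 0%R y (om t))%E by exact: green_ge0.
under [leRHS]eq_integral do rewrite EFinD ge0_muleDr ?lee_fin//.
have mom' : measurable_fun setT (fun t => (om t y (e1_dn hd))%:E) by exact/measurable_EFinP.
rewrite ge0_integralD//.
- rewrite leeD2l//; under [leRHS]eq_integral do rewrite muleC.
  by rewrite ge0_integralZl_EFin.
- by move=> t _; rewrite mule_ge0 ?lee_fin.
- exact: emeasurable_funM.
- by move=> t _; rewrite mule_ge0 ?lee_fin.
- by apply: emeasurable_funM => //; exact: measurable_cst.
Qed.

Lemma kalikow_condition_e1 : kalikow_condition P om (e1vec R d).
Proof.
apply: (lt_le_trans kalikow_gt0); apply: lb_le_inf.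
  exists (kalikow_drift_dot P om [set 0] 0 0 (e1vec R d)), [set 0], 0; split => //.
  - move=> x y -> ->; exists 0%N, [ffun=> e1_up hd].
    by split=> [k|]; rewrite /pos /= big_ord0 addr0.
  - move=> /seteqP[_ /(_ (unitv (e1_up hd)) I)] /= /(congr1 (level hd)).
    by rewrite -[unitv _]add0r level_up level0.
move=> _ [B [y [connB _ B0 By ->]]].
have dot_unitv e : dotR (unitv e) (e1vec R d) = (level hd (0 + unitv e))%:~R.
  by rewrite (dotR_e1vec hd) add0r.
rewrite /kalikow_drift_dot (sum_e1_up_dn (hd := hd)) => [|e neq_up neq_dn].
  by rewrite !dot_unitv level_up level_dn level0 add0r sub0r mulr1 mulrN1 kalikow_env_drift_ge.
by rewrite dot_unitv level_other// level0 mulr0.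
Qed.

End KalikowCondition.

(** * Integer paths and renewal *)

Lemma le_of_natmul_le (R : archiRealFieldType) (u v K : R) :
  (forall n, n%:R * u <= n%:R * v + K) -> u <= v.
Proof.
move=> uv; rewrite leNgt; apply/negP => vu; have := uv (Num.truncn (K / (u - v))).+1.
rewrite -lerBlDl -mulrBr -ler_pdivlMr ?subr_gt0// leNgt => /negP; apply.
exact: truncnS_gt.
Qed.

Section Events.
Context (R : realType) dT (T : measurableType dT) (Q : probability T R).

Lemma probability_lty (A : set T) : measurable A -> (Q A < +oo)%E.
Proof. by move=> mA; exact: le_lt_trans (probability_le1 Q mA) (ltry 1). Qed.

Lemma bigcup_probability_le (A : nat -> set T) (b : \bar R) : (forall n, measurable (A n)) ->
  {homo A : n m / (n <= m)%N >-> n `<=` m} -> (forall n, (Q (A n) <= b)%E) ->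
  (Q (\bigcup_n A n) <= b)%E.
Proof.
move=> mA ndA Ab.
have QA_cvg : (fun n => Q (A n)) @ \oo --> Q (\bigcup_n A n).
  apply: nondecreasing_cvg_mu => //; first exact: bigcupT_measurable.
  by move=> n m nm; apply/subsetPset; exact: ndA.
rewrite -(cvg_lim _ QA_cvg)//; apply: lime_le; first exact: cvgP QA_cvg.
exact: nearW.
Qed.

Lemma probability_bigcap_cvg (A : nat -> set T) : (forall n, measurable (A n)) ->
  {homo A : n m / (n <= m)%N >-> m `<=` n} -> (fun n => Q (A n)) @ \oo --> Q (\bigcap_n A n).
Proof.
move=> mA niA; apply: nonincreasing_cvg_mu => //; [exact: probability_lty | |].
  exact: bigcapT_measurable.
by move=> n m nm; apply/subsetPset; exact: niA.
Qed.

Lemma probability_bigcap_ge (A : nat -> set T) (b : \bar R) : (forall n, measurable (A n)) ->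
  {homo A : n m / (n <= m)%N >-> m `<=` n} -> (forall n, (b <= Q (A n))%E) ->
  (b <= Q (\bigcap_n A n))%E.
Proof.
move=> mA niA bA; have QA_cvg := probability_bigcap_cvg mA niA.
rewrite -(cvg_lim _ QA_cvg)//; apply: lime_ge; first exact: cvgP QA_cvg.
exact: nearW.
Qed.

Lemma ae_notin_null (A : set T) : measurable A -> Q A = 0%E -> {ae Q, forall t, ~ A t}.
Proof. by move=> mA A0; exists A; split=> // t /contrapT. Qed.

Lemma ae_probability1 (A : set T) : measurable A -> Q A = 1%E -> {ae Q, forall t, A t}.
Proof.
move=> mA A1; apply/(negligibleP _ (measurableC mA)).
by rewrite [LHS](probability_setC Q mA) A1 subee.
Qed.

Lemma ae_le_probability (A C : set T) : measurable A -> measurable C ->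
  {ae Q, forall t, A t -> C t} -> (Q A <= Q C)%E.
Proof.
move=> mA mC [N [mN N0 AC]]; rewrite -(measureU0 mC mN N0); apply: le_measure; rewrite ?inE//.
  exact: measurableU.
by move=> t At; case: (pselect (C t)) => Ct; [left | right; apply: AC => /(_ At)].
Qed.

Lemma ae_eq_probability (A C : set T) : measurable A -> measurable C ->
  {ae Q, forall t, A t <-> C t} -> Q A = Q C.
Proof.
move=> mA mC AC; apply/eqP; rewrite eq_le.
by rewrite !ae_le_probability//; apply: filterS AC => t [].
Qed.

Lemma probability_eq0_of_natmul_le (A : set T) (K : R) : measurable A ->
  (forall n, (n%:R%:E * Q A <= K%:E)%E) -> Q A = 0%E.
Proof.
move=> mA nA; have fA : Q A \is a fin_num by exact: fin_num_measure.
apply/eqP; rewrite eq_le measure_ge0 andbT -(fineK fA) lee_fin.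
apply: (@le_of_natmul_le _ _ _ K) => n; rewrite mulr0 add0r -lee_fin EFinM fineK//.
Qed.

End Events.

HB.instance Definition _ := isPointed.Build int 0.

Section PathSpace.

Definition determined (n : nat) (A : set (nat -> int)) : Prop :=
  forall y y', (forall k, (k <= n)%N -> y k = y' k) -> A y -> A y'.

Definition cylinders : set (set (nat -> int)) := [set A | exists n, determined n A].

Definition path_space : measurableType cylinders.-sigma := g_sigma_algebraType cylinders.

Implicit Types (y : path_space) (A : set path_space).

Lemma determined_le n m A : (n <= m)%N -> determined n A -> determined m A.
Proof. by move=> nm dA y y' yy'; apply: dA => k kn; apply: yy'; exact: leq_trans nm. Qed.

Lemma determinedI n A A' : determined n A -> determined n A' -> determined n (A `&` A').
Proof. by move=> dA dA' y y' yy' [Ay A'y]; split; [exact: dA Ay | exact: dA' A'y]. Qed.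

Lemma cylinders_setI : setI_closed cylinders.
Proof.
move=> A A' [n dA] [m dA']; exists (maxn n m); apply: determinedI.
  by apply: determined_le dA; exact: leq_maxl.
by apply: determined_le dA'; exact: leq_maxr.
Qed.

Lemma determined_measurable n A : determined n A -> measurable A.
Proof. by move=> dA; apply: sub_sigma_algebra; exists n. Qed.

Definition first_hit (i n : nat) : set path_space :=
  [set y | y n = i%:Z /\ forall k, (k < n)%N -> y k < i%:Z].

Definition restart (n i : nat) y : path_space := fun k => y (n + k)%N - i%:Z.

Definition nonneg_upto (m : nat) : set path_space := [set y | forall k, (k <= m)%N -> 0 <= y k].

Definition nonneg_path : set path_space := [set y | forall k, 0 <= y k].

Definition below_upto (L n : nat) : set path_space :=
  [set y | forall k, (k <= n)%N -> y k < L%:Z].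

Definition skip_free_upto (n : nat) : set path_space :=
  [set y | y 0%N = 0 /\ forall k, (k < n)%N -> y k.+1 <= y k + 1].

Definition regeneration (j : nat) : set path_space :=
  [set y | exists2 n, first_hit j n y & forall k, (n <= k)%N -> j%:Z <= y k].

Lemma determined_first_hit i n : determined n (first_hit i n).
Proof.
move=> y y' yy' [yn y_lt]; split=> [|k kn]; first by rewrite -yy'.
by rewrite -yy' ?y_lt// ltnW.
Qed.

Lemma determined_nonneg_upto m : determined m (nonneg_upto m).
Proof. by move=> y y' yy' y_ge0 k km; rewrite -yy'// y_ge0. Qed.

Lemma determined_below_upto L n : determined n (below_upto L n).
Proof. by move=> y y' yy' y_lt k kn; rewrite -yy'// y_lt. Qed.

Lemma determined_skip_free_upto n : determined n (skip_free_upto n).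
Proof.
move=> y y' yy' [y0 y_step]; split=> [|k kn]; first by rewrite -yy'.
by rewrite -!yy'// ?y_step// ltnW.
Qed.

Lemma determined_restart n i m A : determined m A -> determined (n + m)%N (restart n i @^-1` A).
Proof. by move=> dA y y' yy'; apply: dA => k km; rewrite /restart yy'// leq_add2l. Qed.

Lemma measurable_first_hit i n : measurable (first_hit i n).
Proof. exact: determined_measurable (@determined_first_hit i n). Qed.

Lemma measurable_nonneg_upto m : measurable (nonneg_upto m).
Proof. exact: determined_measurable (@determined_nonneg_upto m). Qed.

Lemma measurable_below_upto L n : measurable (below_upto L n).
Proof. exact: determined_measurable (@determined_below_upto L n). Qed.

Lemma nonneg_pathE : nonneg_path = \bigcap_m nonneg_upto m.
Proof. by apply/seteqP; split=> y y_ge0 => [m _ k _|k]; [|exact: (y_ge0 k I k)]. Qed.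

Lemma measurable_nonneg_path : measurable nonneg_path.
Proof. by rewrite nonneg_pathE; apply: bigcapT_measurable; exact: measurable_nonneg_upto. Qed.

Lemma measurable_restart n i : measurable_fun setT (restart n i).
Proof.
apply: measurability => // _ [A [m dA] <-]; rewrite setTI.
exact: determined_measurable (@determined_restart n i m A dA).
Qed.

Lemma measurable_preimage_restart n i A : measurable A -> measurable (restart n i @^-1` A).
Proof. by move=> mA; rewrite -[X in measurable X]setTI; exact: measurable_restart. Qed.

Lemma regenerationE j :
  regeneration j = \bigcup_n (first_hit j n `&` restart n j @^-1` nonneg_path).
Proof.
apply/seteqP; split=> y.
  by move=> [n yn y_ge]; exists n => //; split=> // k; rewrite /restart subr_ge0 y_ge// leq_addr.
move=> [n _ [yn y_ge]]; exists n => // k nk.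
by have := y_ge (k - n)%N; rewrite /restart subr_ge0 subnKC.
Qed.

Lemma measurable_regeneration j : measurable (regeneration j).
Proof.
rewrite regenerationE; apply: bigcupT_measurable => n.
apply: measurableI; first exact: measurable_first_hit.
exact: measurable_preimage_restart measurable_nonneg_path.
Qed.

Lemma first_hit_inj i n n' y : first_hit i n y -> first_hit i n' y -> n = n'.
Proof.
move=> [yn y_lt] [yn' y_lt']; case: (ltngtP n n') => // nn'.
  by have := y_lt' _ nn'; rewrite yn ltxx.
by have := y_lt _ nn'; rewrite yn' ltxx.
Qed.

Lemma first_hit_ltn i j n m y : (i < j)%N -> first_hit i n y -> first_hit j m y -> (n < m)%N.
Proof.
move=> ij [yn y_lt] [ym _]; rewrite ltnNge leq_eqVlt; apply/negP => /orP[/eqP mn|mn].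
  by move: yn; rewrite -mn ym => -[ji]; rewrite ji ltnn in ij.
by have := y_lt _ mn; rewrite ym ltz_nat ltnNge ltnW.
Qed.

Lemma first_hit_restart i j n m y : first_hit i n y ->
  first_hit j m (restart n i y) <-> first_hit (i + j) (n + m) y.
Proof.
move=> [yn y_lt]; rewrite /first_hit /restart /=; split=> -[ym ym_lt].
  split=> [|k km]; first by rewrite PoszD -ym; ring.
  case: (ltnP k n) => kn; first by rewrite (lt_le_trans (y_lt _ kn))// lez_nat leq_addr.
  have := ym_lt (k - n)%N; rewrite subnKC// ltrBlDl PoszD; apply.
  by rewrite ltn_subLR.
split=> [|k km]; first by rewrite ym PoszD; ring.
by rewrite ltrBlDl -PoszD ym_lt// ltn_add2l.
Qed.

Lemma first_hit_restartE i j n m y : first_hit i n y -> first_hit (i + j) m y ->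
  (n <= m)%N /\ first_hit j (m - n) (restart n i y).
Proof.
move=> yn ym; have nm : (n <= m)%N.
  case: j ym => [|j] ym; first by rewrite addn0 in ym; rewrite (first_hit_inj yn ym).
  by apply/ltnW/(first_hit_ltn _ yn ym); rewrite addnS ltnS leq_addr.
by split=> //; apply/first_hit_restart => //; rewrite subnKC.
Qed.

Lemma regeneration_restart i j n y : first_hit i n y ->
  regeneration j (restart n i y) <-> regeneration (i + j) y.
Proof.
move=> yn; split=> -[m ym y_ge].
  exists (n + m)%N => [|k km]; first exact/first_hit_restart.
  have nk : (n <= k)%N by apply: leq_trans km; exact: leq_addr.
  have := y_ge (k - n)%N; rewrite /restart subnKC// lerBrDl PoszD; apply.
  by rewrite leq_subRL.
have [nm ym'] := first_hit_restartE yn ym; exists (m - n)%N => // k mk.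
by rewrite /restart lerBrDl -PoszD y_ge// -(subnKC nm) leq_add2l.
Qed.

End PathSpace.

(* After the first visit to level [i], as long as it does not go below [i], the path only sees
   fresh environment, hence is independent of its past. *)
Definition renewal_law (R : realType) (Q : set path_space -> \bar R) : Prop :=
  forall i n m (F A : set path_space), determined n F -> F `<=` first_hit i n ->
    determined m A -> A `<=` nonneg_upto m ->
    Q (F `&` restart n i @^-1` A) = (Q F * Q A)%E.

Section Renewal.
Context (R : realType) (Q : probability path_space R).
Hypothesis renewal : renewal_law Q.

Lemma renewal_nonneg_determined i n m (F A : set path_space) :
  determined n F -> F `<=` first_hit i n -> determined m A ->
  Q (F `&` restart n i @^-1` (A `&` nonneg_path)) = (Q F * Q (A `&` nonneg_path))%E.
Proof.
move=> dF Fi dA; have mF := determined_measurable dF.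
pose A_ k := A `&` nonneg_upto (m + k).
have dA_ k : determined (m + k)%N (A_ k).
  by apply: determinedI; [apply: determined_le dA; exact: leq_addr |
    exact: determined_nonneg_upto].
have mA_ k : measurable (A_ k) := determined_measurable (dA_ k).
have niA k l : (k <= l)%N -> A_ l `<=` A_ k.
  by move=> kl y [Ay y_ge0]; split=> // j jm; apply: y_ge0; rewrite (leq_trans jm)// leq_add2l.
have AE : A `&` nonneg_path = \bigcap_k A_ k.
  apply/seteqP; split=> [y [Ay y_ge0] k _|y yA]; first by split=> // j _.
  by split=> [|k]; [case: (yA 0%N I) | case: (yA k I) => _; apply; exact: leq_addl].
have lhs_cvg : (fun k => Q (F `&` restart n i @^-1` A_ k)) @ \oo -->
    Q (F `&` restart n i @^-1` (A `&` nonneg_path)).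
  rewrite AE preimage_bigcap -bigcapIr; last by exists 0%N.
  apply: probability_bigcap_cvg => [k|k l kl y [Fy Ay]].
    by apply: measurableI => //; exact: measurable_preimage_restart.
  by split=> //; exact: niA Ay.
apply: (cvg_unique _ lhs_cvg) => //.
rewrite (_ : (fun k => _) = fun k => (Q F * Q (A_ k))%E); last first.
  by apply/funext => k; apply: (renewal dF Fi (dA_ k)) => y [].
by rewrite AE; apply: cvgeZl; [exact: fin_num_measure | exact: probability_bigcap_cvg].
Qed.

Lemma renewal_nonneg i n (F A : set path_space) :
  determined n F -> F `<=` first_hit i n -> measurable A ->
  Q (F `&` restart n i @^-1` (A `&` nonneg_path)) = (Q F * Q (A `&` nonneg_path))%E.
Proof.
move=> dF Fi mA; have mF := determined_measurable dF.
have fineF : 0 <= fine (Q F) by exact: fine_ge0.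
pose mS := measurable_nonneg_path; pose mr := measurable_restart n i.
pose m0 : {measure set path_space -> \bar R} := pushforward (mrestr Q mF) (restart n i).
pose m1 : {measure set path_space -> \bar R} := mrestr (m0 mr) mS.
pose m2 : {measure set path_space -> \bar R} := mscale (NngNum fineF) (mrestr Q mS).
have m1E B : m1 B = Q (F `&` restart n i @^-1` (B `&` nonneg_path)) by rewrite setIC.
have m2E B : m2 B = (Q F * Q (B `&` nonneg_path))%E.
  by congr (_ * _)%E; apply: fineK; exact: fin_num_measure.
rewrite -m1E -m2E.
apply: (@measure_unique _ R path_space cylinders (fun=> setT) _ _ _ _ m1 m2) => //.
- exact: cylinders_setI.
- by move=> k; exists 0%N.
- by rewrite bigcup_const//; exists 0%N.
- by move=> B [m dB]; rewrite m1E m2E; exact: renewal_nonneg_determined dB.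
- move=> k; rewrite m1E; apply: probability_lty; apply: measurableI => //.
  by apply: measurable_preimage_restart; apply: measurableI.
Qed.

Lemma renewal_first_hit i (F : nat -> set path_space) (A : set path_space) :
  (forall n, determined n (F n)) -> (forall n, F n `<=` first_hit i n) -> measurable A ->
  Q (\bigcup_n (F n `&` restart n i @^-1` (A `&` nonneg_path))) =
  (Q (\bigcup_n F n) * Q (A `&` nonneg_path))%E.
Proof.
move=> dF Fi mA.
have mF n : measurable (F n) := determined_measurable (dF n).
have mAS : measurable (A `&` nonneg_path).
  by apply: measurableI => //; exact: measurable_nonneg_path.
have tF (G : nat -> set path_space) : trivIset setT (fun n => F n `&` G n).
  move=> n m _ _ [y [[/Fi yn _] [/Fi ym _]]]; exact: first_hit_inj yn ym.
rewrite !measure_bigcup//.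
- rewrite -(fineK (fin_num_measure Q _ mAS)) muleC -nneseriesZl//; apply: eq_eseriesr => n _.
  by rewrite fineK ?fin_num_measure// muleC; exact: renewal_nonneg.
- by have := tF (fun=> setT); under eq_fun do rewrite setIT.
- by move=> n _; apply: measurableI => //; exact: measurable_preimage_restart.
Qed.

End Renewal.

(** * Regeneration levels and slow levels *)

Section Counting.
Implicit Types (b : nat -> bool) (tau : nat -> nat).

Lemma sum_bool_le_last b n : (0 < \sum_(j < n) b j)%N ->
  exists j, [/\ (j < n)%N, b j & (\sum_(j < n) b j <= j.+1)%N].
Proof.
elim: n => [|n IHn]; first by rewrite big_ord0.
rewrite big_ord_recr /=; case: (boolP (b n)) => bn /=; last first.
  by rewrite addn0 => /IHn[j [jn bj sum_le]]; exists j; rewrite leqW.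
move=> _; exists n; split=> //; rewrite addn1 ltnS -[leqRHS]card_ord -sum1_card.
by apply: leq_sum => j _; exact: leq_b1.
Qed.

Lemma greedy_covering b tau a M N s : {homo tau : i j / (i <= j)%N} ->
  (forall i, b i -> exists n, [/\ (0 < n)%N, (n <= M)%N &
    (a * \sum_(i <= j < i + n) b j <= tau (i + n) - tau i)%N]) ->
  (a * \sum_(s <= i < N) b i <= tau (N + M) - tau s)%N.
Proof.
move=> tau_mono window; have [k] := ubnP (N - s); elim: k s => // k IHk s Ns.
have [Nles|sN] := leqP N s; first by rewrite big_geq ?muln0.
have [bs|nbs] := boolP (b s); last first.
  rewrite big_ltn// (negbTE nbs) add0n; apply: (leq_trans (IHk s.+1 _)); first lia.
  by apply: leq_sub2l; apply: tau_mono; lia.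
have [n [n0 nM sum_le]] := window s bs.
have tau_s : (tau s <= tau (s + n))%N by apply: tau_mono; lia.
have tau_sn : (tau (s + n) <= tau (N + M))%N by apply: tau_mono; lia.
have [snN|Nsn] := leqP (s + n) N.
  rewrite (@big_cat_nat _ _ _ (s + n)%N s N)//= ?leq_addr// mulnDr.
  have rest_le : (a * \sum_(s + n <= i < N) b i <= tau (N + M) - tau (s + n))%N.
    by apply: IHk; lia.
  by lia.
have : (\sum_(s <= i < N) b i <= \sum_(s <= i < s + n) b i)%N.
  by rewrite (@big_cat_nat _ _ _ N s (s + n)%N)//= ?leq_addr//; lia.
by move=> /(leq_mul (leqnn a)); lia.
Qed.

End Counting.

Section HittingTimes.
Implicit Types y : path_space.

Definition hits_every_level : set path_space := [set y | forall i, exists n, first_hit i n y].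

Definition hitting_times y (tau : nat -> nat) : Prop := forall i, first_hit i (tau i) y.

Lemma hitting_timesP y : hits_every_level y -> exists tau, hitting_times y tau.
Proof. by move=> hy; have [tau htau] := choice hy; exists tau. Qed.

Lemma hitting_times_ltn y tau i j : hitting_times y tau -> (i < j)%N -> (tau i < tau j)%N.
Proof. by move=> htau ij; exact: first_hit_ltn ij (htau i) (htau j). Qed.

Lemma hitting_times_leq y tau : hitting_times y tau -> {homo tau : i j / (i <= j)%N}.
Proof. by move=> htau; apply: ltnW_homo => i j; exact: hitting_times_ltn. Qed.

Lemma hitting_times_ge y tau n : hitting_times y tau -> (n <= tau n)%N.
Proof.
by move=> htau; elim: n => // n /leq_ltn_trans; apply; exact: hitting_times_ltn.
Qed.

Lemma measurable_hits_every_level : measurable hits_every_level.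
Proof.
rewrite [X in measurable X](_ : _ = \bigcap_i \bigcup_n first_hit i n).
  by apply: bigcapT_measurable => i; apply: bigcupT_measurable; exact: measurable_first_hit.
apply/seteqP; split=> y hy i; first by move=> _; have [n yn] := hy i; exists n.
by have [n _ yn] := hy i I; exists n.
Qed.

Lemma skip_free_first_hit y L n : (forall m, skip_free_upto m y) -> ~ below_upto L n y ->
  exists m, first_hit L m y.
Proof.
move=> sf nb.
have ex_ge : exists k, L%:Z <= y k.
  apply: contrapT => all_lt; apply: nb => k _; rewrite ltNge; apply/negP => yk.
  by apply: all_lt; exists k.
case: (ex_minnP ex_ge) => m ym m_min; exists m.
have y_lt k : (k < m)%N -> y k < L%:Z.
  by move=> km; rewrite ltNge; apply/negP => /m_min; rewrite leqNgt km.
split=> //; apply/eqP; rewrite eq_le ym andbT.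
case: m ym m_min y_lt => [|m] ym m_min y_lt; first by have [-> _] := sf 0%N; rewrite lez_nat.
have [_ /(_ m (ltnSn m)) y_step] := sf m.+1.
by apply: (le_trans y_step); rewrite lezD1 y_lt.
Qed.

End HittingTimes.

Section SlowLevels.
Implicit Types (y : path_space) (a M N i n : nat).

Definition regen_count n y : nat := (\sum_(j < n) (y \in regeneration j))%N.

Definition slow a M : set path_space := [set y | exists n, [/\ (0 < n)%N, (n <= M)%N &
  exists2 t, first_hit n t y & (a * regen_count n y < t)%N]].

Definition slow_at a M i : set path_space :=
  \bigcup_n (first_hit i n `&` restart n i @^-1` (slow a M `&` nonneg_path)).

Lemma regen_count_restart i n t y : first_hit i t y ->
  regen_count n (restart t i y) = (\sum_(j < n) (y \in regeneration (i + j)))%N.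
Proof.
move=> yt; apply: eq_bigr => j _; congr nat_of_bool.
by apply/idP/idP => /set_mem yj; exact/mem_set/(regeneration_restart _ yt).
Qed.

Lemma slow_atP a M i y tau : hitting_times y tau ->
  slow_at a M i y <-> regeneration i y /\ exists n, [/\ (0 < n)%N, (n <= M)%N &
    (a * \sum_(j < n) (y \in regeneration (i + j)) < tau (i + n) - tau i)%N].
Proof.
move=> htau; split.
  move=> [t _ [yt [[n [n0 nM [t' yt' slow_t']]] y_ge0]]]; split.
    by rewrite regenerationE; exists t.
  exists n; split=> //; rewrite -(regen_count_restart n yt) -(first_hit_inj yt (htau i)).
  have /first_hit_inj/(_ (htau (i + n)%N)) <- : first_hit (i + n) (t + t') y.
    exact/(first_hit_restart _ _ yt).
  by rewrite addKn.
rewrite regenerationE => -[[t _ [yt y_ge0]] [n [n0 nM slow_n]]].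
exists t => //; split=> //; split=> //; exists n; split=> //.
have [t_le y_hit] := first_hit_restartE yt (htau (i + n)%N).
exists (tau (i + n) - t)%N => //.
by rewrite (regen_count_restart n yt) (first_hit_inj yt (htau i)).
Qed.

Lemma slow_at_homo a i : {homo slow_at a ^~ i : M M' / (M <= M')%N >-> M `<=` M'}.
Proof.
move=> M M' MM' y [t _ [yt [[n [n0 nM slow_n]] y_ge0]]].
by exists t => //; split=> //; split=> //; exists n; split=> //; exact: leq_trans MM'.
Qed.

Lemma slow_at_covering a M N y tau : hitting_times y tau ->
  (a * \sum_(i < N) (y \in slow_at a M i) <= tau (N + M))%N.
Proof.
move=> htau; rewrite -(big_mkord xpredT (fun i => y \in slow_at a M i : nat)).
apply: leq_trans (leq_subr (tau 0%N) _).
apply: greedy_covering (hitting_times_leq htau) _ => i /set_mem/(slow_atP _ _ _ htau)[_].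
move=> [n [n0 nM slow_n]]; exists n; split=> //; apply: leq_trans (ltnW slow_n).
rewrite leq_mul2l -{1}[i]add0n [(i + n)%N]addnC big_addn addnK big_mkord leq_sum ?orbT// => j _.
rewrite addnC; case: (boolP (y \in slow_at _ _ _)) => //= /set_mem/(slow_atP _ _ _ htau)[yj _].
by rewrite mem_set.
Qed.

(* The last regeneration level before time [m] bounds the level from below, and there is one as
   high as their number, which is at least the elapsed time divided by [a]. *)
Lemma linear_growth y a i : hits_every_level y -> regeneration i y ->
  (forall M, ~ slow_at a M i y) ->
  exists K : nat, forall m, (K <= m)%N -> m%:Z <= a%:Z * (y m + 1) + K%:Z.
Proof.
move=> /hitting_timesP[tau htau] yi not_slow; exists (tau i) => m tau_m.
have ex_n : exists n, (m < tau (i + n))%N.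
  by exists m.+1; apply: leq_trans (hitting_times_ge _ htau); exact: leq_addl.
case: (ex_minnP ex_n) => n m_lt n_min.
have n0 : (0 < n)%N by case: n m_lt {n_min} => //; rewrite addn0 ltnNge tau_m.
have time_le : (tau (i + n) - tau i <= a * \sum_(j < n) (y \in regeneration (i + j)))%N.
  rewrite leqNgt; apply/negP => slow_n; apply: (not_slow n).
  by apply/(slow_atP _ _ _ htau); split=> //; exists n.
have count_gt0 : (0 < \sum_(j < n) (y \in regeneration (i + j)))%N.
  by rewrite lt0n; apply/eqP => count0; move: time_le; rewrite count0 muln0; lia.
have [j [jn /set_mem yj count_le]] :=
  @sum_bool_le_last (fun j => y \in regeneration (i + j)) n count_gt0.
have [t yt y_ge] := yj.
have t_le : (t <= m)%N.
  rewrite (first_hit_inj yt (htau _)) leqNgt; apply/negP => /n_min; lia.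
have := y_ge m t_le; move: time_le count_le; set r := (\sum_(_ < n) _)%N => time_le count_le ym.
have : m%:Z <= (a * r)%N%:Z + (tau i)%:Z by lia.
move/le_trans; apply; rewrite lerD2r PoszM ler_wpM2l//.
by lia.
Qed.

Lemma measurable_regen_count_lt a n t : measurable [set y | (a * regen_count n y < t)%N].
Proof.
have m_regen j : measurable_fun setT (fun y : path_space => nat_of_bool (y \in regeneration j)).
  rewrite (_ : (fun y => _) = fun y => if y \in regeneration j then 1%N else 0%N).
    apply: measurable_fun_ifT => //; apply: (measurable_fun_bool true).
    rewrite setTI [X in measurable X](_ : _ = regeneration j); first exact: measurable_regeneration.
    by apply/seteqP; split=> y /=; [move/set_mem | move/mem_set].
  by apply/funext => y; case: (_ \in _).
have m_count : measurable_fun [set: path_space] (regen_count n).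
  rewrite /regen_count; elim: n => [|n IHn].
    by under eq_fun do rewrite big_ord0; exact: measurable_cst.
  by under eq_fun do rewrite big_ord_recr; exact: measurable_fun_addn.
by have := m_count measurableT [set k | (a * k < t)%N]; rewrite setTI; exact.
Qed.

Lemma measurable_slow a M : measurable (slow a M).
Proof.
rewrite [X in measurable X](_ : _ = \bigcup_(n in [set n | (0 < n <= M)%N]) \bigcup_t
  (first_hit n t `&` [set y | (a * regen_count n y < t)%N])).
  apply: bigcup_measurable => n _; apply: bigcupT_measurable => t.
  by apply: measurableI; [exact: measurable_first_hit | exact: measurable_regen_count_lt].
apply/seteqP; split=> y.
  by move=> [n [n0 nM [t yt slow_t]]]; exists n; [rewrite /= n0 | exists t].
by move=> [n /andP[n0 nM] [t _ [yt slow_t]]]; exists n; split=> //; exists t.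
Qed.

Lemma measurable_slow_at a M i : measurable (slow_at a M i).
Proof.
apply: bigcupT_measurable => n; apply: measurableI; first exact: measurable_first_hit.
apply: measurable_preimage_restart; apply: measurableI; first exact: measurable_slow.
exact: measurable_nonneg_path.
Qed.

End SlowLevels.

(** * Almost sure linear growth *)

Section Undercut.
Implicit Types (y : path_space) (i j n : nat).

Definition undercut j n : set path_space :=
  [set y | exists2 k, (k <= n)%N & y k < j%:Z /\ exists2 m, (m <= k)%N & first_hit j m y].

Definition undercut_upto j n : set path_space :=
  [set y | forall j', (j' <= j)%N -> undercut j' n y].

Definition undercut_before j i : set path_space :=
  \bigcup_n (first_hit i n `&` undercut_upto j n).

Definition never_regenerates : set path_space := \bigcap_j ~` regeneration j.

Definition no_regeneration_upto j : set path_space :=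
  \bigcap_(j' in [set j' | (j' <= j)%N]) ~` regeneration j'.

Lemma undercut_homo j : {homo undercut j : n n' / (n <= n')%N >-> n `<=` n'}.
Proof. by move=> n n' nn' y [k kn yk]; exists k => //; exact: leq_trans nn'. Qed.

Lemma determined_undercut_upto j n : determined n (undercut_upto j n).
Proof.
move=> y y' yy' uy j' /uy[k kn [yk [m mk ym]]]; exists k => //; split; first by rewrite -yy'.
exists m => //; apply: determined_first_hit ym => l lm.
by apply: yy'; rewrite (leq_trans lm)// (leq_trans mk).
Qed.

Lemma undercut_not_regeneration j n y : undercut j n y -> ~ regeneration j y.
Proof.
move=> [k kn [yk [m mk ym]]] [m' ym' y_ge].
by have := y_ge k; rewrite -(first_hit_inj ym ym') leNgt yk => /(_ mk).
Qed.

Lemma not_regeneration_undercut j m y : first_hit j m y -> ~ regeneration j y ->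
  exists n, undercut j n y.
Proof.
move=> ym not_regen; apply: contrapT => not_undercut; apply: not_regen.
exists m => // k mk; rewrite leNgt; apply/negP => yk.
by apply: not_undercut; exists k; exists k => //; split=> //; exists m.
Qed.

Lemma exists_undercut_upto j y : hits_every_level y -> never_regenerates y ->
  exists n, undercut_upto j n y.
Proof.
move=> hy never; have undercutP j' : exists n, undercut j' n y.
  by have [m ym] := hy j'; exact: not_regeneration_undercut ym (never j' I).
elim: j => [|j [N uN]].
  by have [n un] := undercutP 0%N; exists n => j'; rewrite leqn0 => /eqP ->.
have [n un] := undercutP j.+1; exists (maxn N n) => j'; rewrite leq_eqVlt => /predU1P[->|].
  by apply: undercut_homo un; exact: leq_maxr.
by rewrite ltnS => /uN; apply: undercut_homo; exact: leq_maxl.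
Qed.

Lemma undercut_before_homo j y i i' : hits_every_level y -> (i <= i')%N ->
  undercut_before j i y -> undercut_before j i' y.
Proof.
move=> /hitting_timesP[tau htau] ii' [n _ [yn uy]]; exists (tau i') => //; split=> //.
move=> j' /uy; apply: undercut_homo; rewrite (first_hit_inj yn (htau i)).
exact: hitting_times_leq htau _ _ ii'.
Qed.

Lemma never_regenerates_undercut j y : hits_every_level y -> never_regenerates y ->
  exists i, undercut_before j i y.
Proof.
move=> hy never; have [N uN] := exists_undercut_upto j hy never.
have [tau htau] := hitting_timesP hy; exists N, (tau N) => //; split=> // j' /uN.
by apply: undercut_homo; exact: hitting_times_ge htau.
Qed.

Lemma measurable_undercut_before j i : measurable (undercut_before j i).
Proof.
apply: bigcupT_measurable => n; apply: measurableI; first exact: measurable_first_hit.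
exact: determined_measurable (@determined_undercut_upto j n).
Qed.

Lemma measurable_never_regenerates : measurable never_regenerates.
Proof. by apply: bigcapT_measurable => j; apply: measurableC; exact: measurable_regeneration. Qed.

Lemma measurable_no_regeneration_upto j : measurable (no_regeneration_upto j).
Proof.
by apply: bigcap_measurableType => k _; apply: measurableC; exact: measurable_regeneration.
Qed.

Lemma never_regeneratesE : never_regenerates = \bigcap_j no_regeneration_upto j.
Proof.
apply/seteqP; split=> y ny j _; first by move=> j' _; exact: ny.
by apply: (ny j I); rewrite /= leqnn.
Qed.

End Undercut.

Section LinearGrowth.
Context (R : realType) (Q : probability path_space R) (c : R).
Hypothesis c0 : 0 < c.
Hypothesis renewal : renewal_law Q.
Hypothesis skip_freeQ : forall n, Q (skip_free_upto n) = 1%E.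
Hypothesis timeQ : forall L k : nat, (0 < L)%N ->
  (\sum_(n < k) Q (below_upto L n) <= (L%:R / c)%:E)%E.
Hypothesis nonnegQ : forall n, (c%:E <= Q (nonneg_upto n))%E.

Lemma below_forever_null L : (0 < L)%N -> Q (\bigcap_n below_upto L n) = 0%E.
Proof.
move=> L0; have mB : measurable (\bigcap_n below_upto L n).
  by apply: bigcapT_measurable; exact: measurable_below_upto.
apply: (@probability_eq0_of_natmul_le _ _ _ Q _ (L%:R / c)) => // k; apply: le_trans (timeQ k L0).
have -> : (k%:R%:E * Q (\bigcap_n below_upto L n) =
    \sum_(n < k) Q (\bigcap_n below_upto L n))%E.
  by rewrite -(fineK (fin_num_measure Q _ mB)) sumEFin sumr_const card_ord -EFinM mulr_natl.
apply: lee_sum => n _; apply: le_measure; rewrite ?inE//; first exact: measurable_below_upto.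
exact: bigcap_inf.
Qed.

Lemma ae_hits_every_level : {ae Q, forall y, hits_every_level y}.
Proof.
have ae_skip_free : {ae Q, forall y n, skip_free_upto n y}.
  apply: ae_foralln => n; apply: ae_probability1 => //.
  exact: determined_measurable (@determined_skip_free_upto n).
have ae_not_below : {ae Q, forall y L, ~ (\bigcap_n below_upto L.+1 n) y}.
  apply: ae_foralln => L; apply: ae_notin_null; last exact: below_forever_null.
  by apply: bigcapT_measurable; exact: measurable_below_upto.
apply: filterS2 ae_skip_free ae_not_below => y sf nb L.
have [n nbn] : exists n, ~ below_upto L n y.
  case: L => [|L]; last by apply/existsNP => below; apply: (nb L) => n _; exact: below.
  by exists 0%N => /(_ 0%N isT); have [-> _] := sf 0%N.
exact: skip_free_first_hit sf nbn.
Qed.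

Lemma nonneg_path_probability_ge : (c%:E <= Q nonneg_path)%E.
Proof.
rewrite nonneg_pathE; apply: probability_bigcap_ge => //; first exact: measurable_nonneg_upto.
by move=> n m nm y y_ge0 k kn; apply: y_ge0; exact: leq_trans nm.
Qed.

(* Leaving all levels up to [j] downwards before reaching level [i] is independent of [i] being a
   regeneration level. *)
Lemma undercut_before_probability_le j i :
  (Q (undercut_before j i) * c%:E + Q never_regenerates <= Q (no_regeneration_upto j))%E.
Proof.
pose F n := first_hit i n `&` undercut_upto j n.
have dF n : determined n (F n).
  by apply: determinedI; [exact: determined_first_hit | exact: determined_undercut_upto].
have Fi n : F n `<=` first_hit i n by move=> y [].
have mFr : measurable (\bigcup_n (F n `&` restart n i @^-1` (setT `&` nonneg_path))).
  apply: bigcupT_measurable => n; apply: measurableI; first exact: determined_measurable (dF n).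
  by apply: measurable_preimage_restart; rewrite setTI; exact: measurable_nonneg_path.
apply: (@le_trans _ _ (Q (undercut_before j i) * Q (setT `&` nonneg_path) + Q never_regenerates)%E).
  by rewrite leeD2r// setTI lee_wpmul2l//; exact: nonneg_path_probability_ge.
rewrite -(renewal_first_hit renewal dF Fi)// -measureU//; last 2 first.
- exact: measurable_never_regenerates.
- apply/seteqP; split=> y // -[[n _ [[yn _] [_ y_ge0]]] /(_ i I)]; apply.
  by rewrite regenerationE; exists n.
apply: le_measure; rewrite ?inE.
- by apply: measurableU => //; exact: measurable_never_regenerates.
- exact: measurable_no_regeneration_upto.
move=> y [[n _ [[_ uy] _]]|]; first by move=> j' /uy/undercut_not_regeneration.
by rewrite never_regeneratesE; apply.
Qed.

Lemma never_regenerates_probability_le j :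
  (Q never_regenerates * c%:E + Q never_regenerates <= Q (no_regeneration_upto j))%E.
Proof.
have mN := measurable_never_regenerates; have mH := measurable_hits_every_level.
have fN : Q never_regenerates \is a fin_num by exact: fin_num_measure.
have fNj : Q (no_regeneration_upto j) \is a fin_num.
  by apply: fin_num_measure; exact: measurable_no_regeneration_upto.
pose b := (fine (Q (no_regeneration_upto j)) - fine (Q never_regenerates)) / c.
suff : (Q never_regenerates <= b%:E)%E.
  rewrite -(fineK fN) lee_fin ler_pdivlMr// lerBrDr.
  by rewrite -lee_fin EFinD EFinM !fineK.
pose U i := undercut_before j i `&` hits_every_level.
have mU i : measurable (U i).
  by apply: measurableI => //; exact: measurable_undercut_before.
apply: (@le_trans _ _ (Q (\bigcup_i U i))).
  apply: ae_le_probability => //; first exact: bigcupT_measurable.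
  apply: filterS ae_hits_every_level => y hy never.
  by have [i yi] := never_regenerates_undercut j hy never; exists i.
apply: bigcup_probability_le => // [i i' ii' y [yi hy]|i].
  by split=> //; exact: undercut_before_homo hy ii' yi.
have fU : Q (undercut_before j i) \is a fin_num.
  by apply: fin_num_measure; exact: measurable_undercut_before.
apply: (@le_trans _ _ (Q (undercut_before j i))).
  apply: le_measure; rewrite ?inE; [exact: mU | | exact: subIsetl].
  exact: measurable_undercut_before.
rewrite -(fineK fU) lee_fin ler_pdivlMr// lerBrDr -lee_fin EFinD EFinM !fineK//.
exact: undercut_before_probability_le.
Qed.

Lemma never_regenerates_null : Q never_regenerates = 0%E.
Proof.
have fN : Q never_regenerates \is a fin_num.
  by apply: fin_num_measure; exact: measurable_never_regenerates.
have : (Q never_regenerates * c%:E + Q never_regenerates <= Q never_regenerates)%E.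
  rewrite {3}never_regeneratesE; apply: probability_bigcap_ge.
  - exact: measurable_no_regeneration_upto.
  - by move=> n m nm y yN k /= kn; apply: yN; exact: leq_trans nm.
  - exact: never_regenerates_probability_le.
have : (0 <= Q never_regenerates)%E by [].
rewrite -(fineK fN) -EFinM -EFinD !lee_fin gerDr pmulr_lle0// => p_ge0 p_le0.
by congr EFin; apply/eqP; rewrite eq_le p_le0.
Qed.

Lemma slow_at_probability a M i : Q (slow_at a M i) = Q (slow a M `&` nonneg_path).
Proof.
rewrite [LHS](renewal_first_hit renewal (@determined_first_hit i) (fun n => @subset_refl _ _)
  (measurable_slow a M)).
have mH : measurable (\bigcup_n first_hit i n).
  by apply: bigcupT_measurable; exact: measurable_first_hit.
suff -> : Q (\bigcup_n first_hit i n) = 1%E by rewrite mul1e.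
apply/eqP; rewrite eq_le probability_le1//= -[leLHS](probability_setT Q).
apply: ae_le_probability => //; apply: filterS ae_hits_every_level => y hy _.
by have [n yn] := hy i; exists n.
Qed.

Lemma expected_time_below_le L : (0 < L)%N ->
  (\int[Q]_y \sum_(0 <= n <oo) (\1_(below_upto L n) y)%:E <= (L%:R / c)%:E)%E.
Proof.
move=> L0; rewrite integral_nneseries//; last first.
  by move=> n; apply/measurable_EFinP; exact: measurable_indic (measurable_below_upto L n).
apply: lime_le; first by apply: is_cvg_nneseries => n _ _; exact: integral_ge0.
apply: nearW => k; rewrite big_mkord (eq_bigr (fun n : 'I_k => Q (below_upto L n))) ?timeQ// => n _.
by rewrite integral_indic ?setIT//; exact: measurable_below_upto.
Qed.

Lemma hitting_time_le_time_below L y tau : hitting_times y tau ->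
  ((tau L)%:R%:E <= \sum_(0 <= n <oo) (\1_(below_upto L n) y : R)%:E)%E.
Proof.
move=> htau; have ind_ge0 n : 0 <= (\1_(below_upto L n) y : R) by [].
apply: le_trans (nneseries_ge_partial (tau L) ind_ge0).
rewrite lee_fin (eq_bigr (fun=> 1)) ?sumr_const ?card_ord// => n _.
rewrite indicE mem_set// => k kn; have [_] := htau L; apply.
exact: leq_ltn_trans kn _.
Qed.

Lemma mean_slow_count_le a M N :
  N%:R * (a%:R * fine (Q (slow a M `&` nonneg_path))) <= (N + M)%:R / c.
Proof.
case: N => [|N]; first by rewrite mul0r divr_ge0// ltW.
have m_slow_at i := measurable_slow_at a M i.
have b_slow_at i : bounded_mfun (\1_(slow_at a M i) : path_space -> R).
  exact: bounded_mfun_indic.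
have b_count : bounded_mfun (fun y => a%:R * \sum_(i < N.+1) (\1_(slow_at a M i) y : R)) by [].
have -> : N.+1%:R * (a%:R * fine (Q (slow a M `&` nonneg_path))) =
    \int[Q]_y (a%:R * \sum_(i < N.+1) \1_(slow_at a M i) y).
  rewrite RintegralZl// Rintegral_sum// mulrCA; congr (_ * _).
  rewrite (eq_bigr (fun=> fine (Q (slow a M `&` nonneg_path)))).
    by rewrite sumr_const card_ord mulr_natl.
  by move=> i _; rewrite /Rintegral integral_indic// setIT -(slow_at_probability a M i).
rewrite -lee_fin EFin_Rintegral//; apply: le_trans (expected_time_below_le _); last by [].
apply: ae_ge0_le_integral => //.
- by move=> y _; rewrite lee_fin mulr_ge0// sumr_ge0.
- by apply/measurable_EFinP; exact: b_count.1.
- by move=> y _; apply: nneseries_ge0 => n _ _; rewrite lee_fin.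
- apply: ge0_emeasurable_sum => n *; first by rewrite lee_fin.
  by apply/measurable_EFinP; exact: measurable_indic (measurable_below_upto _ n).
apply: filterS ae_hits_every_level => y /hitting_timesP[tau htau] _.
apply: le_trans (hitting_time_le_time_below _ htau); rewrite lee_fin.
have := slow_at_covering a M N.+1 htau; rewrite -(ler_nat R) natrM natr_sum.
by under [in X in _ -> X]eq_bigr do rewrite indicE.
Qed.

Lemma slow_probability_le a M : a%:R * fine (Q (slow a M `&` nonneg_path)) <= c^-1.
Proof.
apply: (@le_of_natmul_le _ _ _ (M%:R / c)) => N.
by apply: (le_trans (mean_slow_count_le a M N)); rewrite natrD mulrDl.
Qed.

Lemma slow_at_all_speeds_null i : Q (\bigcap_a \bigcup_M slow_at a M i) = 0%E.
Proof.
have mU a : measurable (\bigcup_M slow_at a M i).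
  by apply: bigcupT_measurable => M; exact: measurable_slow_at.
apply: (@probability_eq0_of_natmul_le _ _ _ Q _ c^-1) => [|[|a]]; first exact: bigcapT_measurable.
  by rewrite mul0e lee_fin invr_ge0 ltW.
rewrite muleC -lee_pdivlMr ?ltr0n//.
apply: (@le_trans _ _ (Q (\bigcup_M slow_at a.+1 M i))).
  by apply: le_measure; rewrite ?inE//; [exact: bigcapT_measurable | exact: bigcap_inf].
apply: bigcup_probability_le => [M||M]; [exact: measurable_slow_at | exact: slow_at_homo |].
have mS : measurable (slow a.+1 M `&` nonneg_path).
  by apply: measurableI; [exact: measurable_slow | exact: measurable_nonneg_path].
rewrite slow_at_probability -(fineK (fin_num_measure Q _ mS)) -EFinM lee_fin.
by rewrite ler_pdivlMr ?ltr0n// mulrC slow_probability_le.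
Qed.

Lemma ae_linear_growth : {ae Q, forall y : path_space, exists a K : nat,
  forall m, (K <= m)%N -> m%:Z <= a%:Z * (y m + 1) + K%:Z}.
Proof.
have ae_regen : {ae Q, forall y, ~ never_regenerates y}.
  by apply: ae_notin_null; [exact: measurable_never_regenerates | exact: never_regenerates_null].
have ae_not_slow : {ae Q, forall y i, ~ (\bigcap_a \bigcup_M slow_at a M i) y}.
  apply: ae_foralln => i; apply: ae_notin_null; last exact: slow_at_all_speeds_null.
  apply: bigcapT_measurable => a; apply: bigcupT_measurable => M; exact: measurable_slow_at.
apply: filterS3 ae_hits_every_level ae_regen ae_not_slow => y hy regen not_slow.
have [i yi] : exists i, regeneration i y.
  by apply: contrapT => none; apply: regen => i _ yi; apply: none; exists i.
have [a not_slow_a] : exists a, forall M, ~ slow_at a M i y.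
  apply: contrapT => none; apply: (not_slow i) => a _; apply: contrapT => no_M.
  by apply: none; exists a => M yM; apply: no_M; exists M.
have [K growth] := linear_growth hy yi not_slow_a.
by exists a, K.
Qed.

End LinearGrowth.

(** * The law of the level process *)

Section LevelPath.
Context (R : realType) (d : nat) dT (T : measurableType dT) (P : probability T R).
Variables (om : T -> env R d) (X : nat -> T -> Zd d).
Hypothesis hd : (0 < d)%N.
Hypothesis som : prob_vectors om.
Hypothesis iid : iid_env P om.
Hypothesis walk : annealed_walk P om X.
Let mom := iid_env_measurable iid.
Let substoch := prob_vectors_substochastic som.
Implicit Types s : seq (Dir d).

Definition path_prob s : R := \int[P]_t seq_weight (om t) 0 s.

Let bweight x s : bounded_mfun (fun t => seq_weight (om t) x s).
Proof. exact: bounded_mfun_seq_weight. Qed.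

Lemma path_prob_shift x s : \int[P]_t seq_weight (om t) x s = path_prob s.
Proof.
rewrite /path_prob (env_shift_law som iid x (observable_seq_weight R 0 s)).
by under [in RHS]eq_Rintegral do rewrite seq_weight_shift addr0.
Qed.

(* The two pieces of the path visit disjoint half-spaces, hence independent environments. *)
Lemma path_prob_cat (i : int) s s' :
  (forall k, (k < size s)%N -> level hd (endpoint 0 (take k s)) < i) ->
  (forall k, (k < size s')%N -> i <= level hd (endpoint (endpoint 0 s) (take k s'))) ->
  path_prob (s ++ s') = path_prob s * path_prob s'.
Proof.
move=> s_lt s'_ge.
have mixE t t' : seq_weight (mix [pred x | level hd x < i] (om t) (om t')) 0 (s ++ s') =
    seq_weight (om t) 0 s * seq_weight (om t') (endpoint 0 s) s'.
  rewrite seq_weight_cat; congr (_ * _); apply: eq_seq_weight => k ks; rewrite /mix /=.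
    by rewrite s_lt.
  by rewrite ltNge s'_ge.
rewrite /path_prob (env_mix_law som iid [pred x | level hd x < i] (observable_seq_weight R 0 _)).
under eq_Rintegral => t _.
  under eq_Rintegral do rewrite mixE.
  rewrite RintegralZl// path_prob_shift.
  over.
by rewrite RintegralZr.
Qed.

Definition path_cylinder s : set T :=
  [set t | forall k, (k <= size s)%N -> X k t = endpoint 0 (take k s)].

Lemma measurable_path_cylinder s : measurable (path_cylinder s).
Proof.
rewrite [X in measurable X](_ : _ =
  \bigcap_(k in [set k | (k <= size s)%N]) [set t | X k t = endpoint 0 (take k s)]).
  by apply: bigcap_measurableType => k _; exact: walk.1.
by apply/seteqP; split=> t tX k ks; exact: tX.
Qed.

Lemma path_cylinder_probability s : P (path_cylinder s) = (path_prob s)%:E.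
Proof.
rewrite /path_prob EFin_Rintegral//.
have := walk.2 (size s) (ffun_tuple (in_tuple s)).
under eq_integral do rewrite path_weight_ffun_tuple.
move=> <-; congr (P _); apply/seteqP; split=> t tX k.
  by rewrite tX ?pos_ffun_tuple// -ltnS.
by rewrite -ltnS => ks; have := tX (Ordinal ks); rewrite pos_ffun_tuple.
Qed.

Lemma bigcup_path_cylinder_probability n (C : pred (n.-tuple (Dir d))) :
  P (\bigcup_(s in [set` C]) path_cylinder s) = (\sum_(s | C s) path_prob s)%:E.
Proof.
rewrite measure_fin_bigcup//; last 2 first.
- move=> s s' _ _ [t [ts ts']]; apply/val_inj/endpoint_take_inj; rewrite ?size_tuple// => k kn.
  by rewrite -ts ?size_tuple// ts' ?size_tuple.
- by move=> s _; exact: measurable_path_cylinder.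
rewrite -(bigfs _ (index_enum_uniq _)) => [|s _]; last by rewrite mem_index_enum.
by rewrite -sumEFin; apply: eq_bigr => s _; exact: path_cylinder_probability.
Qed.

Lemma survival_sum_path_prob n (B : set (Zd d)) :
  \int[P]_t survival B (om t) n 0 = \sum_(s : n.-tuple (Dir d) | inside B 0 s) path_prob s.
Proof.
rewrite -big_filter -Rintegral_sum//; apply: eq_Rintegral => t _.
rewrite /survival -killed_tupleE big_filter.
by apply: eq_bigr => s _; rewrite mulr1.
Qed.

Lemma ae_path_cylinder n : {ae P, forall t, exists s : n.-tuple (Dir d), path_cylinder s t}.
Proof.
pose U := \bigcup_(s in [set` [pred s : n.-tuple (Dir d) | inside setT 0 s]]) path_cylinder s.
have mU : measurable U.
  apply: fin_bigcup_measurable => [|s _]; first exact: finite_finset.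
  exact: measurable_path_cylinder.
have ae_U : {ae P, forall t, U t}.
  apply: ae_probability1 => //; rewrite [LHS]bigcup_path_cylinder_probability.
  rewrite -survival_sum_path_prob; congr EFin; rewrite -[RHS](Rintegral_cstT P).
  by apply: eq_Rintegral => t _; rewrite survival_setT// => u; exact: som.2.
by apply: filterS ae_U => t [s _ ts]; exists s.
Qed.

Definition level_path (t : T) : path_space := fun k => level hd (X k t).

Definition levels s : path_space := fun k => level hd (endpoint 0 (take k s)).

Lemma path_cylinder_levels s t k : path_cylinder s t -> (k <= size s)%N ->
  level_path t k = levels s k.
Proof. by move=> ts ks; rewrite /level_path ts. Qed.

Lemma measurable_level_path : measurable_fun setT level_path.
Proof.
apply: measurability => // _ [A [n dA] <-]; rewrite setTI.
pose D := [set z : n.+1.-tuple (Zd d) | A (fun k => level hd (nth 0 z k))].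
pose F (z : n.+1.-tuple (Zd d)) := \bigcap_(k in [set k | (k <= n)%N]) [set t | X k t = nth 0 z k].
rewrite [X in measurable X](_ : _ = \bigcup_(z in D) F z).
  rewrite bigcup_mkcond; apply: countable_bigcupT_measurable => [|z]; first exact: countableP.
  by case: ifP => // _; apply: bigcap_measurableType => k _; exact: walk.1.
apply/seteqP; split=> t; last first.
  by move=> [z Az tz]; apply: (dA _ _ _ Az) => k kn; rewrite /level_path (tz k kn).
move=> At; pose z : n.+1.-tuple (Zd d) := [tuple X k t | k < n.+1].
have zE k : (k <= n)%N -> nth 0 z k = X k t.
  by rewrite -ltnS => kn; rewrite -(tnth_nth 0 z (Ordinal kn)) tnth_mktuple.
exists z => [|k kn]; last by rewrite zE.
by apply: dA At => k kn; rewrite zE.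
Qed.

Lemma level_path_probability n (A : set path_space) : determined n A ->
  P (level_path @^-1` A) =
  (\sum_(s : n.-tuple (Dir d) | `[< A (levels s) >]) path_prob s)%:E.
Proof.
move=> dA; pose C := [pred s : n.-tuple (Dir d) | `[< A (levels s) >]].
rewrite -(bigcup_path_cylinder_probability C); apply: ae_eq_probability.
- by rewrite -[X in measurable X]setTI; apply: measurable_level_path => //;
    exact: determined_measurable dA.
- apply: fin_bigcup_measurable => [|s _]; first exact: finite_finset.
  exact: measurable_path_cylinder.
apply: filterS (ae_path_cylinder n) => t [s ts]; split=> [At|[s' /asboolP As' ts']].
  exists s => //; apply/asboolP; apply: dA At => k kn.
  by apply: path_cylinder_levels => //; rewrite size_tuple.
by apply: dA As' => k kn; rewrite -(path_cylinder_levels ts') ?size_tuple.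
Qed.

Lemma level_path_survival n (B : set (Zd d)) (A : set path_space) : determined n A ->
  (forall s, size s = n ->
    A (levels s) <-> forall k, (k <= n)%N -> B (endpoint 0 (take k s))) ->
  P (level_path @^-1` A) = (\int[P]_t survival B (om t) n 0)%:E.
Proof.
move=> dA AB; rewrite (level_path_probability dA) survival_sum_path_prob; congr EFin.
apply: eq_bigl => s; apply/asboolP/insideP; rewrite size_tuple.
  by move=> /(AB _ (size_tuple s)).
by move=> sB; apply/(AB _ (size_tuple s)).
Qed.

Lemma levels_catl s s' k : (k <= size s)%N -> levels (s ++ s') k = levels s k.
Proof. by move=> ks; rewrite /levels takel_cat. Qed.

Lemma restart_levels_cat (i : nat) s s' : level hd (endpoint 0 s) = i%:Z ->
  restart (size s) i (levels (s ++ s')) = levels s'.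
Proof.
move=> si; apply/funext => k.
rewrite /restart /levels take_cat ltnNge leq_addr /= addKn endpoint_cat -si.
by rewrite /level /endpoint !add0r !mxE addrAC subrr add0r.
Qed.

Lemma skip_free_levels s : skip_free_upto (size s) (levels s).
Proof.
split=> [|k ks]; first by rewrite /levels take0 endpoint_nil level0.
by rewrite /levels (endpoint_take_S _ (e1_up hd) ks) level_step_le.
Qed.

Lemma level_path_renewal : renewal_law (fun A => P (level_path @^-1` A)).
Proof.
move=> i n m F A dF Fi dA A_ge0.
have dFA : determined (n + m)%N (F `&` restart n i @^-1` A).
  apply: determinedI; first by apply: determined_le dF; exact: leq_addr.
  exact: determined_restart.
rewrite (level_path_probability dFA) (level_path_probability dF) (level_path_probability dA) -EFinM.
congr EFin.
rewrite (big_tuple_cat n m path_prob (fun s => `[< (F `&` restart n i @^-1` A) (levels s) >])).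
rewrite mulr_suml [RHS]big_mkcond; apply: eq_bigr => s _; rewrite mulr_sumr.
have levels_s (s' : seq (Dir d)) : F (levels (s ++ s')) <-> F (levels s).
  by split; apply: dF => k kn; rewrite levels_catl ?size_tuple.
case: asboolP => [Fs|nFs]; last first.
  by rewrite big_pred0// => s'; apply/asboolP => -[/levels_s].
have [s_end s_lt] := Fi _ Fs; rewrite /levels take_oversize ?size_tuple// in s_end.
have restartE (s' : seq (Dir d)) : restart n i (levels (s ++ s')) = levels s'.
  by rewrite -[n in restart n](size_tuple s); exact: restart_levels_cat.
apply: eq_big => [s'|s' /asboolP[_ As']].
  apply: asbool_equiv_eq; rewrite /= /preimage /= restartE; split=> [[]//|As'].
  by split=> //; exact/levels_s.
rewrite /preimage /= restartE in As'.
apply: (@path_prob_cat i) => [k|k ks']; first by rewrite size_tuple => kn; exact: s_lt.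
have := A_ge0 _ As' k; rewrite -(restartE s') /restart /levels take_cat size_tuple.
rewrite ltnNge leq_addr /= addKn endpoint_cat subr_ge0; apply.
by rewrite ltnW// -(size_tuple s').
Qed.

End LevelPath.

Lemma limn_einf_gt0 (R : realType) (u : nat -> R) (a K : nat) :
  (forall m, (K <= m)%N -> m%:R <= a%:R * (u m + 1) + K%:R) ->
  (0 < limn_einf (fun n => (u n / n%:R)%:E))%E.
Proof.
move=> growth; have a0 : 0 < a%:R :> R.
  rewrite ltr0n lt0n; apply/eqP => a0; have := growth K.+1 (leqnSn K).
  by rewrite a0 mul0r add0r ler_nat ltnn.
apply: (@lt_le_trans _ _ ((2 * a%:R)^-1)%:E).
  by rewrite lte_fin invr_gt0 mulr_gt0.
rewrite limn_einf_lim; apply: lime_ge; first exact: is_cvg_einfs.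
exists (2 * (K + a)).+1 => // n /= n_large; apply: le_ereal_inf_tmp => _ [m /= nm <-].
have m_large : (2 * (K + a) < m)%N by exact: leq_trans nm.
have m0 : 0 < m%:R :> R by rewrite ltr0n; exact: leq_ltn_trans m_large.
have Km : (K <= m)%N by lia.
have growth_m := growth m Km.
have m_ge : 2 * (K%:R + a%:R) <= m%:R :> R by rewrite -natrD -natrM ler_nat ltnW.
by rewrite lee_fin ler_pdivlMr// mulrC ler_pdivrMr ?mulr_gt0//; lra.
Qed.

Section LevelLaw.
Context (R : realType) (d : nat) dT (T : measurableType dT) (P : probability T R).
Variables (om : T -> env R d) (X : nat -> T -> Zd d).
Hypothesis hd : (0 < d)%N.
Hypothesis som : prob_vectors om.
Hypothesis iid : iid_env P om.
Hypothesis eps01 : 0 < eps_env P om < 1.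
Hypothesis kalikow_gt0 : 0 < kalikow_const P om.
Hypothesis walk : annealed_walk P om X.
Let c := kalikow_const P om.

Let level_rv : {mfun T >-> path_space} := HB.pack (level_path X hd)
  (isMeasurableFun.Build _ _ _ _ _ (measurable_level_path hd walk)).
Let level_law : probability path_space R := distribution P level_rv.

Let level_law_survival n (B : set (Zd d)) (A : set path_space) : determined n A ->
  (forall s, size s = n ->
    A (levels hd s) <-> forall k, (k <= n)%N -> B (endpoint 0 (take k s))) ->
  level_law A = (\int[P]_t survival B (om t) n 0)%:E.
Proof. exact: level_path_survival. Qed.

Lemma ae_level_linear_growth : {ae P, forall t, exists a K : nat,
  forall m, (K <= m)%N -> m%:Z <= a%:Z * (level hd (X m t) + 1) + K%:Z}.
Proof.
have skip_free n : level_law (skip_free_upto n) = 1%E.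
  rewrite (level_law_survival (B := setT) (@determined_skip_free_upto n)) => [|s <-].
    rewrite -[1%E](congr1 EFin (Rintegral_cstT P 1)); congr EFin.
    by apply: eq_Rintegral => t _; rewrite survival_setT// => u; exact: som.2.
  by split=> // _; exact: skip_free_levels.
have time L k : (0 < L)%N -> (\sum_(n < k) level_law (below_upto L n) <= (L%:R / c)%:E)%E.
  move=> L0; rewrite (eq_bigr (fun n : 'I_k =>
      (\int[P]_t survival [set x | level hd x < L%:Z] (om t) n 0)%:E)) => [|n _].
    by rewrite sumEFin lee_fin (annealed_time_sum_le hd som iid eps01 kalikow_gt0).
  exact: level_law_survival (@determined_below_upto L n) _.
have stay n : (c%:E <= level_law (nonneg_upto n))%E.
  rewrite (level_law_survival (B := [set x | 0 <= level hd x]) (@determined_nonneg_upto n))//.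
  by rewrite lee_fin annealed_survival_ge.
have renewal : renewal_law level_law by exact: (level_path_renewal hd som iid walk).
have [N [mN N0 growth]] := ae_linear_growth kalikow_gt0 renewal skip_free time stay.
exists (level_path X hd @^-1` N); split=> //; last by move=> t /growth.
by rewrite -[X in measurable X]setTI; exact: (measurable_level_path hd walk measurableT mN).
Qed.

End LevelLaw.

Theorem theorem1p2 (R : realType) (d : nat) (hd : (2 <= d)%N)
  (dT : measure_display) (T : measurableType dT) (P : probability T R)
  (om : T -> env R d) (X : nat -> T -> Zd d) :
  prob_vectors om ->
  iid_env P om ->
  0 < eps_env P om < 1 ->
  annealed_walk P om X ->
  lambda_env P om > 4 * d%:R * sigma_env P om ^+ 2 * (1 + 9 * eps_env P om) ->
  kalikow_condition P om (e1vec R d) /\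
  {ae P, forall t,
     (0 < limn_einf (fun n => (dotR (X n t) (e1vec R d) / n%:R)%:E))%E}.
Proof.
move=> som iid eps01 walk lambda_gt.
have d0 : (0 < d)%N by exact: ltnW.
have kalikow_gt0 : 0 < kalikow_const P om.
  rewrite subr_gt0; apply: le_lt_trans lambda_gt; have /andP[eps0 _] := eps01.
  by apply: ler_wpM2l; [rewrite mulr_ge0 ?sqr_ge0 ?mulr_ge0 | lra].
split; first exact: (kalikow_condition_e1 d0 som iid eps01 kalikow_gt0).
apply: filterS (ae_level_linear_growth d0 som iid eps01 kalikow_gt0 walk) => t [a [K growth]].
apply: (@limn_einf_gt0 _ _ a K) => m Km; rewrite (dotR_e1vec d0).
by have := growth m Km; rewrite -(ler_int R) !intrD intrM intrD.
Qed.
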